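(* Let $d\ge1$ and $r\ge1$. (1) If $f:M_d^r\to M_d$ is a multilinear trace polynomial in $r$ variables with $f(X_1,\dots,X_r)\ge0$ whenever $X_1,\dots,X_r\ge0$, then there is $\alpha\in\mathbb{C}S_{r+1}$ such that $f(X_1,\dots,X_r)=\operatorname{tr}_{1\dots r}\big[\hat T(\alpha)(X_1\otimes\cdots\otimes X_r\otimes\mathbb{1})\big]$ for all $X_i\in M_d$, and $\hat T(\alpha)$ is a hermitian block-positive operator on $(\mathbb{C}^d)^{\otimes(r+1)}$ satisfying $U^{\otimes(r+1)}\hat T(\alpha)(U^\dagger)^{\otimes(r+1)}=\hat T(\alpha)$ for all unitaries $U\in M_d$. (2) Conversely, if $\mathcal{B}$ is a block-positive operator on $(\mathbb{C}^d)^{\otimes(r+1)}$ with $U^{\otimes(r+1)}\mathcal{B}(U^\dagger)^{\otimes(r+1)}=\mathcal{B}$ for all unitaries $U$, then $f_{\mathcal{B}}(X_1,\dots,X_r)=\operatorname{tr}_{1\dots r}[\mathcal{B}(X_1\otimes\cdots\otimes X_r\otimes\mathbb{1})]$ is a multilinear trace polynomial with $f_{\mathcal{B}}(X_1,\dots,X_r)\ge0$ whenever $X_1,\dots,X_r\ge0$. (3) For such a unitary-invariant operator $\mathcal{W}$, $f_{\mathcal{W}}$ is an optimal trace polynomial inequality on the positive cone if and only if $\mathcal{W}$ is an optimal $U^{\otimes(r+1)}$-invariant (Werner state) entanglement witness.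
   Context: $M_d$ is the set of complex $d\times d$ matrices; $A\ge0$ means $A$ is positive semidefinite. A trace polynomial in variables $X_1,\dots,X_r$ is a complex linear combination of terms $X_{\alpha_1}\cdots X_{\alpha_s}\prod_j\operatorname{tr}(X_{\beta^{(j)}_1}\cdots X_{\beta^{(j)}_{t_j}})$ (a term with no untraced monomial means the scalar times $\mathbb{1}$); it is multilinear if it is linear in each variable. $S_{r+1}$ acts on $(\mathbb{C}^d)^{\otimes(r+1)}$ by $T(\pi)|v_1\rangle\otimes\cdots\otimes|v_{r+1}\rangle=|v_{\pi^{-1}(1)}\rangle\otimes\cdots\otimes|v_{\pi^{-1}(r+1)}\rangle$, and $\hat T(\sum_\pi a_\pi\pi)=\sum_\pi a_\pi T(\pi)$ for elements of the group algebra $\mathbb{C}S_{r+1}$. $\operatorname{tr}_{1\dots r}$ is the partial trace over the first $r$ tensor factors. An operator $\mathcal{B}$ on $(\mathbb{C}^d)^{\otimes(r+1)}$ is block-positive if $\operatorname{tr}[\mathcal{B}\rho]\ge0$ for all separable states $\rho$ (convex combinations of product states $\rho_1\otimes\cdots\otimes\rho_{r+1}$, where states are positive semidefinite matrices of trace one). An entanglement witness is a block-positive $\mathcal{W}$ with $\operatorname{tr}[\mathcal{W}\sigma]<0$ for some (entangled) state $\sigma$; it is optimal if moreover $\operatorname{tr}[\mathcal{W}\tilde\rho]=0$ for some separable state $\tilde\rho$. A trace polynomial $f$ that is positive semidefinite on all tuples of positive semidefinite matrices is an optimal trace polynomial inequality on the positive cone if additionally the smallest eigenvalue of $f(\tilde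 X_1,\dots,\tilde X_r)$ is $0$ for some nonzero positive semidefinite $\tilde X_1,\dots,\tilde X_r$.
   Formalization: In part (3), W is additionally assumed to be an entanglement witness (some state has negative expectation); for a merely block-positive invariant W the equivalence fails, e.g. W = 0 gives an optimal inequality but is not a witness. *)

(* Defs.v *)
From mathcomp Require Import all_boot all_order all_algebra all_fingroup.
From mathcomp Require Import complex reals.
Set Implicit Arguments. Unset Strict Implicit. Unset Printing Implicit Defensive.
Import Order.TTheory GRing.Theory Num.Theory.
Local Open Scope ring_scope.

Section Defs.
Variable R : realType.
Local Notation C := R[i].

Definition adjmx m n (A : 'M[C]_(m, n)) : 'M[C]_(n, m) := map_mx Num.conj A^T.
Definition psd d (A : 'M[C]_d) : Prop :=
  forall v : 'cV[C]_d, 0 <= (adjmx v *m A *m v) 0 0.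
Definition unitary d (U : 'M[C]_d) : Prop := U *m adjmx U = 1%:M.
Definition state d (A : 'M[C]_d) : Prop := psd A /\ \tr A = 1.

(* A term: coefficient, untraced word X_{a1}...X_{as}, list of traced words. *)
Definition tterm (r : nat) := (C * (seq 'I_r * seq (seq 'I_r)))%type.
Definition tpoly (r : nat) := seq (tterm r).

Definition mword d r (w : seq 'I_r) (X : 'I_r -> 'M[C]_d) : 'M[C]_d :=
  \big[mulmx/1%:M]_(a <- w) X a.

Definition tp_eval d r (p : tpoly r) (X : 'I_r -> 'M[C]_d) : 'M[C]_d :=
  \sum_(t <- p) (t.1 * \prod_(w <- t.2.2) \tr (mword w X)) *: mword t.2.1 X.

Definition tp_multilinear r (p : tpoly r) : Prop :=
  forall t, t \in p -> forall i : 'I_r,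
    count (pred1 i) (t.2.1 ++ flatten t.2.2) = 1%N.

(* basis multi-indices of the k-fold tensor power *)
Definition tidx k d := {ffun 'I_k -> 'I_d}.
(* operators, given by their matrix entries in the product basis *)
Definition top k d := tidx k d -> tidx k d -> C.

Definition top_mul k d (A B : top k d) : top k d :=
  fun i j => \sum_(l : tidx k d) A i l * B l j.
Definition top_tr k d (A : top k d) : C := \sum_(i : tidx k d) A i i.
Definition top_hermitian k d (A : top k d) : Prop :=
  forall i j, A i j = Num.conj (A j i).
Definition top_psd k d (A : top k d) : Prop :=
  forall v : tidx k d -> C,
    0 <= \sum_(i : tidx k d) \sum_(j : tidx k d) Num.conj (v i) * A i j * v j.
Definition top_state k d (A : top k d) : Prop := top_psd A /\ top_tr A = 1.

Definition tens k d (A : 'I_k -> 'M[C]_d) : top k d :=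
  fun i j => \prod_(m : 'I_k) A m (i m) (j m).

Definition extX r d (X : 'I_r -> 'M[C]_d) (m : 'I_r.+1) : 'M[C]_d :=
  match unlift ord_max m with Some m' => X m' | None => 1%:M end.

Definition ptr r d (B : top r.+1 d) : 'M[C]_d :=
  \matrix_(a, b) \sum_(i : tidx r.+1 d | i ord_max == a)
     B i [ffun m => if m == ord_max then b else i m].

Definition fB r d (B : top r.+1 d) (X : 'I_r -> 'M[C]_d) : 'M[C]_d :=
  ptr (top_mul B (tens (extX X))).

(* permutation operator T(pi): T(pi)|v_1..v_k> = |v_{pi^-1(1)} .. v_{pi^-1(k)}> *)
Definition Tperm k d (pi : 'S_k) : top k d :=
  fun i j => ([forall m : 'I_k, i m == j ((pi^-1)%g m)])%:R.
Definition That k d (alpha : {ffun 'S_k -> C}) : top k d :=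
  fun i j => \sum_(pi : 'S_k) alpha pi * @Tperm k d pi i j.

Definition unitary_invariant k d (B : top k d) : Prop :=
  forall U : 'M[C]_d, unitary U ->
    top_mul (top_mul (tens (fun _ => U)) B) (tens (fun _ => adjmx U)) = B.

Definition separable k d (rho : top k d) : Prop :=
  exists (n : nat) (p : 'I_n -> C) (rhos : 'I_n -> 'I_k -> 'M[C]_d),
    (forall l, 0 <= p l) /\ \sum_(l < n) p l = 1 /\
    (forall l m, state (rhos l m)) /\
    rho = (fun i j => \sum_(l < n) p l * tens (rhos l) i j).

Definition block_positive k d (B : top k d) : Prop :=
  forall rho : top k d, separable rho -> 0 <= top_tr (top_mul B rho).

Definition entanglement_witness k d (W : top k d) : Prop :=
  block_positive W /\ exists sigma : top k d, top_state sigma /\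
    top_tr (top_mul W sigma) < 0.

Definition optimal_witness k d (W : top k d) : Prop :=
  entanglement_witness W /\ exists rho : top k d, separable rho /\
    top_tr (top_mul W rho) = 0.

Definition pos_on_cone r d (f : ('I_r -> 'M[C]_d) -> 'M[C]_d) : Prop :=
  forall X : 'I_r -> 'M[C]_d, (forall i, psd (X i)) -> psd (f X).

Definition smallest_eigenvalue_zero d (A : 'M[C]_d) : Prop :=
  eigenvalue A 0 /\ forall a, eigenvalue A a -> 0 <= a.

Definition optimal_tp_ineq r d (f : ('I_r -> 'M[C]_d) -> 'M[C]_d) : Prop :=
  pos_on_cone f /\
  exists Xt : 'I_r -> 'M[C]_d, (forall i, psd (Xt i) /\ Xt i != 0) /\
    smallest_eigenvalue_zero (f Xt).

End Defs.
Arguments That {R k} d alpha _ _.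

(* Main.v *)
(** The functional [tr (B (X_1 (x) .. (x) X_r (x) Y))] equals [tr (f_B(X) Y)],
    so positivity of [f_B] on psd tuples is positivity of [B] on product states,
    and a kernel vector of [f_B(X)] is a product state on which [B] vanishes.

    A multilinear trace monomial times a last variable [Y] is a product of traces
    of words using each letter once, i.e. [tr (T(s) (X (x) Y))] for the
    permutation [s] having those words as cycles.

    An invariant [B] lies in the span of the [T(s)] (Schur-Weyl duality).  If
    [B] commutes with [U^(x)k] for all unitary [U], then also for diagonal
    matrices (compare weights), hermitian ones (spectral theorem), all matrices
    (polynomial in [z] on [A + z A'] with [A], [A'] hermitian), and by polarization
    with every symmetrized product.  Evaluated on matrix units, the last
    commutation forces every functional killing all [T(s)] to kill [B]. *)
Require Import Defs.
From mathcomp Require Import all_boot all_order all_algebra all_fingroup.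
From mathcomp Require Import complex reals.
From mathcomp Require Import cyclic cyclotomic spectral sesquilinear boolp ring.
From mathcomp Require separable.
Set Implicit Arguments. Unset Strict Implicit. Unset Printing Implicit Defensive.
Import Order.TTheory GRing.Theory Num.Theory.
Local Open Scope ring_scope.

(** * Positive semidefinite matrices *)

Lemma mxtrace_mul_delta (F : comNzRingType) d (K : 'M[F]_d) (i j : 'I_d) :
  \tr (K *m delta_mx j i) = K i j.
Proof.
rewrite /mxtrace (bigD1 i) //= big1 ?addr0 => [|k ki].
  rewrite mxE (bigD1 j) //= big1 ?addr0 => [|k kj].
    by rewrite [X in _ * X]mxE !eqxx mulr1.
  by rewrite [X in _ * X]mxE (negPf kj) mulr0.
by rewrite mxE big1 // => l _; rewrite [X in _ * X]mxE (negPf ki) andbF mulr0.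
Qed.

Section PositiveSemidefinite.
Variable C : numClosedFieldType.
Implicit Types d m n : nat.
Local Notation adjmx A := (map_mx Num.conj A^T).

(** Stated over any [numClosedFieldType]; at [R[i]] it is convertible to [psd]. *)
Definition psdmx d (A : 'M[C]_d) : Prop :=
  forall v : 'cV[C]_d, 0 <= (adjmx v *m A *m v) 0 0.


Lemma adjmxK m n (A : 'M[C]_(m, n)) : adjmx (adjmx A) = A.
Proof. by apply/matrixP=> i j; rewrite !mxE conjCK. Qed.

Lemma adjmxM m n p (A : 'M[C]_(m, n)) (B : 'M[C]_(n, p)) :
  adjmx (A *m B) = adjmx B *m adjmx A.
Proof. by rewrite trmx_mul map_mxM. Qed.

Lemma adjmx0 m n : adjmx (0 : 'M[C]_(m, n)) = 0.
Proof. by apply/matrixP=> i j; rewrite !mxE rmorph0. Qed.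

Lemma normsq_cV d (v : 'cV[C]_d) :
  (adjmx v *m v) 0 0 = \sum_i `|v i 0| ^+ 2.
Proof. by rewrite mxE; apply: eq_bigr => i _; rewrite !mxE normCK mulrC. Qed.

Lemma normsq_cV_ge0 d (v : 'cV[C]_d) : 0 <= (adjmx v *m v) 0 0.
Proof. by rewrite normsq_cV sumr_ge0 // => i _; rewrite exprn_ge0. Qed.

Lemma normsq_cV_eq0 d (v : 'cV[C]_d) : (adjmx v *m v) 0 0 = 0 -> v = 0.
Proof.
rewrite normsq_cV => /eqP; rewrite psumr_eq0 => [|i _]; last exact: exprn_ge0.
move=> /allP v0; apply/colP=> i; rewrite mxE; apply/eqP.
by have /= := v0 i (mem_index_enum i); rewrite expf_eq0 normr_eq0.
Qed.

Lemma trmulmx_dyad d (A : 'M[C]_d) (u v : 'cV[C]_d) :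
  \tr (A *m (u *m adjmx v)) = (adjmx v *m A *m u) 0 0.
Proof. by rewrite mulmxA mxtrace_mulC mulmxA /mxtrace big_ord1. Qed.

Lemma psd_dyad d (v : 'cV[C]_d) : psdmx (v *m adjmx v).
Proof.
move=> u; rewrite mulmxA -mulmxA.
have -> : adjmx u *m v = adjmx (adjmx v *m u) by rewrite adjmxM adjmxK.
exact: normsq_cV_ge0.
Qed.

Lemma psdZ d c (A : 'M[C]_d) : 0 <= c -> psdmx A -> psdmx (c *: A).
Proof. by move=> c0 A0 v; rewrite -scalemxAr -scalemxAl mxE mulr_ge0. Qed.

(* Polarization over the fourth roots of unity w:
   4 e_i e_j^* = sum_w w (e_i + w e_j)(e_i + w e_j)^*. *)
Lemma delta_mx_dyads d (i j : 'I_d) :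
  let D (w : C) := (delta_mx i 0 + w *: delta_mx j 0) *m
     adjmx (delta_mx i 0 + w *: delta_mx j 0 : 'cV[C]_d) in
  delta_mx i j = 4^-1 *: (D 1 - D (-1) + 'i *: (D 'i - D (- 'i))).
Proof.
move=> D; apply/matrixP=> a b.
have E w : D w a b = ((a == i)%:R + w * (a == j)%:R) *
   ((b == i)%:R + w^* * (b == j)%:R).
  by rewrite !mxE big_ord1 !mxE !andbT rmorphD rmorphM /= !rmorph_nat.
move: E; clearbody D => E; rewrite !mxE !{}E -mulnb natrM.
move: (a == i)%:R (b == j)%:R (a == j)%:R (b == i)%:R => p t q s.
rewrite !rmorphN rmorph1 /= conjCi.
have i2 : 'i * 'i = -1 :> C by rewrite -expr2 sqrCi.
have four : (4 : C) != 0 by rewrite pnatr_eq0.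
apply: (mulfI four); rewrite [in RHS]mulrA mulfV // mul1r.
transitivity (2 * (p * t + q * s) - 2 * ('i * 'i) * (p * t - q * s)); last by ring.
by rewrite i2; ring.
Qed.

Lemma delta_mx_dyadsE d (i j : 'I_d) : exists v1 v2 v3 v4 : 'cV[C]_d,
  delta_mx i j = 4^-1 *: (v1 *m adjmx v1 - v2 *m adjmx v2 +
                    'i *: (v3 *m adjmx v3 - v4 *m adjmx v4)).
Proof. by do 4!eexists; exact: delta_mx_dyads. Qed.

(** The form of [A] is real, so [A - adjmx A] has trace zero against every dyad, and by polarization
    dyads span all matrices. *)
Lemma psd_hermitian d (A : 'M[C]_d) : psdmx A -> adjmx A = A.
Proof.
move=> A0; apply/esym/eqP; rewrite -subr_eq0; apply/eqP.
have K0 (v : 'cV[C]_d) : \tr ((A - adjmx A) *m (v *m adjmx v)) = 0.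
  have -> : \tr ((A - adjmx A) *m (v *m adjmx v)) =
      (adjmx v *m A *m v - adjmx (adjmx v *m A *m v)) 0 0.
    by rewrite trmulmx_dyad mulmxBr mulmxBl !adjmxM adjmxK mulmxA.
  move: (A0 v); set w := adjmx v *m A *m v => /ger0_real/CrealP E.
  by clearbody w; rewrite !mxE E subrr.
move: (A - adjmx A) K0 => K K0; apply/matrixP=> i j.
rewrite -mxtrace_mul_delta; have [v1 [v2 [v3 [v4 ->]]]] := delta_mx_dyadsE j i.
rewrite -scalemxAr mxtraceZ mulmxDr -scalemxAr !mulmxBr.
have trB (X Y : 'M[C]_d) : \tr (X - Y) = \tr X - \tr Y by exact: raddfB.
by rewrite mxtraceD mxtraceZ !trB !K0 !subr0 mulr0 addr0 mulr0 mxE.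
Qed.

Lemma psd_spectral d (A : 'M[C]_d) : psdmx A ->
  exists (D : 'I_d -> C) (V : 'I_d -> 'cV[C]_d),
    [/\ forall k, 0 <= D k, forall k, (adjmx (V k) *m V k) 0 0 = 1 &
        A = \sum_k D k *: (V k *m adjmx (V k))].
Proof.
move=> A0; have AH : A \is hermsymmx.
  by apply/is_hermitianmxP; rewrite expr0 scale1r [LHS](esym (psd_hermitian A0)).
have /orthomx_spectralP := hermitian_normalmx AH.
have Pu := spectral_unitarymx A; rewrite (invmx_unitary Pu).
move: Pu; set P := spectralmx A; set D := spectral_diag A => Pu AE.
have VV k l : (row k P *m adjmx (row l P)) 0 0 = (k == l)%:R.
  have := unitarymxP Pu => /matrixP/(_ k l); rewrite !mxE => <-.
  by apply: eq_bigr => i _; rewrite !mxE.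
have VVV k l : (row k P *m (adjmx (row l P) *m row l P) *m adjmx (row k P)) 0 0
    = (k == l)%:R.
  rewrite mulmxA -(mulmxA (row k P *m _)) mxE big_ord1 !VV (eq_sym l).
  by case: eqP; rewrite ?mulr1 ?mulr0.
have AE' : A = \sum_k D 0 k *: (adjmx (row k P) *m row k P).
  apply/matrixP=> i j; rewrite {1}AE summxE mxE; apply: eq_bigr => k _.
  by rewrite mul_mx_diag !mxE big_ord1 !mxE mulrA (mulrC _ (D 0 k)).
(* The rows of the unitary [P] are orthonormal; their adjoints are eigenvectors of [A], and the form
   of [A] at the k-th one is its eigenvalue, hence nonnegative. *)
exists (fun k => D 0 k), (fun k => adjmx (row k P)); split => [k|k|].
- have := A0 (adjmx (row k P)); rewrite adjmxK AE' mulmx_sumr mulmx_suml summxE.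
  rewrite (bigD1 k) //= big1 => [|l lk].
    by rewrite addr0 -scalemxAr -scalemxAl mxE VVV eqxx mulr1.
  by rewrite -scalemxAr -scalemxAl mxE VVV eq_sym (negPf lk) mulr0.
- by rewrite adjmxK VV eqxx.
- by rewrite {1}AE'; apply: eq_bigr => k _; rewrite adjmxK.
Qed.

Lemma tr_dyad d (v : 'cV[C]_d) : \tr (v *m adjmx v) = (adjmx v *m v) 0 0.
Proof. by rewrite mxtrace_mulC /mxtrace big_ord1. Qed.

Lemma psd_tr_ge0 d (A : 'M[C]_d) : psdmx A -> 0 <= \tr A.
Proof.
move=> /psd_spectral [D [V [D0 VV ->]]]; rewrite linear_sum sumr_ge0 //= => k _.
by rewrite linearZ /= tr_dyad VV mulr1.
Qed.

Lemma psd_tr_eq0 d (A : 'M[C]_d) : psdmx A -> \tr A = 0 -> A = 0.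
Proof.
move=> /psd_spectral [D [V [D0 VV ->]]].
have -> : \tr (\sum_k D k *: (V k *m adjmx (V k))) = \sum_k D k.
  by rewrite linear_sum; apply: eq_bigr => k _; rewrite linearZ /= tr_dyad VV mulr1.
move=> /eqP; rewrite psumr_eq0 // => /allP z; apply: big1 => k _.
by have /= /eqP-> := z k (mem_index_enum k); rewrite scale0r.
Qed.

Lemma psd_trM_ge0 d (A B : 'M[C]_d) : psdmx A -> psdmx B -> 0 <= \tr (A *m B).
Proof.
move=> A0 /psd_spectral [D [V [D0 VV ->]]].
rewrite mulmx_sumr linear_sum sumr_ge0 //= => k _.
by rewrite -scalemxAr linearZ /= trmulmx_dyad mulr_ge0.
Qed.

(** Spectrally the form is a sum of nonnegative terms [D k] times the squared modulus of
    [adjmx (V k) *m v]. Each term vanishes, which kills each summand of [A *m v]. *)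
Lemma psd_form_eq0 d (A : 'M[C]_d) (v : 'cV[C]_d) :
  psdmx A -> (adjmx v *m A *m v) 0 0 = 0 -> A *m v = 0.
Proof.
move=> /psd_spectral [D [V [D0 VV ->]]].
have E k : (adjmx v *m (D k *: (V k *m adjmx (V k))) *m v) 0 0 =
    D k * (adjmx (adjmx (V k) *m v) *m (adjmx (V k) *m v)) 0 0.
  by rewrite -scalemxAr -scalemxAl mxE adjmxM adjmxK !mulmxA.
rewrite mulmx_sumr mulmx_suml summxE => /eqP; rewrite psumr_eq0; last first.
  by move=> k _; rewrite E mulr_ge0 ?normsq_cV_ge0.
move=> /allP z; rewrite mulmx_suml big1 // => k _.
have /= := z k (mem_index_enum k); rewrite E mulf_eq0 => /orP[/eqP->|/eqP w0].
  by rewrite scale0r mul0mx.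
by rewrite -scalemxAl -mulmxA (normsq_cV_eq0 w0) mulmx0 scaler0.
Qed.

(** Expanding [B] spectrally makes the trace a sum of nonnegative terms; an eigenvector of [B] with
    nonzero eigenvalue is then a zero of the form of [A]. *)
Lemma psd_trM_eq0 d (A B : 'M[C]_d) :
  psdmx A -> psdmx B -> B != 0 -> \tr (A *m B) = 0 ->
  exists2 v : 'cV[C]_d, v != 0 & A *m v = 0.
Proof.
move=> A0 /psd_spectral [D [V [D0 VV ->]]] Bn0.
rewrite mulmx_sumr linear_sum => /eqP; rewrite psumr_eq0 => [/allP z|k _]; last first.
  by rewrite -scalemxAr linearZ /= trmulmx_dyad mulr_ge0.
have [k Dk] : exists k, D k != 0.
  apply/existsP; apply: contraR Bn0 => /existsPn D00.
  rewrite big1 // => k _; have := D00 k; rewrite negbK => /eqP->.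
  by rewrite scale0r.
exists (V k).
  apply/eqP=> Vk; have := VV k; rewrite Vk mulmx0 mxE => /eqP.
  by rewrite eq_sym oner_eq0.
apply: psd_form_eq0 => //; have /= := z k (mem_index_enum k).
by rewrite -scalemxAr linearZ /= trmulmx_dyad mulf_eq0 (negPf Dk) => /eqP.
Qed.

(** [eigenvalue] refers to row vectors, while kernel vectors here are columns; as [A] is hermitian,
    adjoints exchange the two. *)
Lemma psd_smallest_eigenvalue_zeroP d (A : 'M[C]_d) : psdmx A ->
  (eigenvalue A 0 /\ forall a, eigenvalue A a -> 0 <= a) <->
  exists2 v : 'cV[C]_d, v != 0 & A *m v = 0.
Proof.
move=> A0; split => [[/eigenvalueP [u] uA un0] _|[v vn0 Av]].
  exists (adjmx u).
    by apply: contra un0 => /eqP E; rewrite -(adjmxK u) E adjmx0.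
  by rewrite -{1}(psd_hermitian A0) -adjmxM uA scale0r adjmx0.
split=> [|a /eigenvalueP [u uA un0]].
  apply/eigenvalueP; exists (adjmx v).
    by rewrite -{1}(psd_hermitian A0) -adjmxM Av scale0r adjmx0.
  by apply: contra vn0 => /eqP E; rewrite -(adjmxK v) E adjmx0.
have := A0 (adjmx u); rewrite adjmxK uA -scalemxAl mxE.
have u0 : (u *m adjmx u) 0 0 != 0.
  apply: contra un0 => /eqP E; rewrite -(adjmxK u).
  by rewrite (@normsq_cV_eq0 _ (adjmx u)) ?adjmxK // adjmx0.
rewrite pmulr_lge0 // lt_def u0.
by have := normsq_cV_ge0 (adjmx u); rewrite adjmxK.
Qed.

End PositiveSemidefinite.

(** * Polarization *)

Lemma prod_boolr (F : comNzRingType) (I : finType) (b : I -> bool) :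
  \prod_m (b m)%:R = ([forall m, b m])%:R :> F.
Proof.
case: (boolP [forall m, b m]) => [/forallP bT|/forallPn[m /negPf bm]].
  by rewrite big1 // => m _; rewrite bT.
by rewrite (bigD1 m) //= bm mul0r.
Qed.

Section Polarization.
Variable C : comNzRingType.
Variable k : nat.

(** The sum over [e] factorizes over [t], with factor -1 for [t] in the range of [f] and 0
    otherwise, so only surjective, that is injective, [f] survive. *)
Lemma ryser_sign (f : {ffun 'I_k -> 'I_k}) :
  \sum_(e : {ffun 'I_k -> bool})
     \prod_t ((-1) ^+ e t * (e t || (t \notin codom f))%:R)
  = ((-1) ^+ k * (injectiveb f)%:R : C).
Proof.
rewrite -(bigA_distr_bigA (fun t (b : bool) =>
  (-1) ^+ b * (b || (t \notin codom f))%:R)).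
have E t : \sum_(b : bool) ((-1) ^+ b * (b || (t \notin codom f))%:R : C)
   = - (t \in codom f)%:R.
  rewrite big_bool /= expr1 mulr1 expr0 mul1r.
  by case: (t \in codom f); rewrite ?addr0 ?addNr ?oppr0.
rewrite (eq_bigr _ (fun t _ => E t)).
case: (boolP (injectiveb f)) => [/injectiveP fi|/injectiveP fi].
  rewrite mulr1 (eq_bigr (fun=> -1)) ?prodr_const ?card_ord // => t _.
  by rewrite (inj_card_onto fi).
rewrite mulr0; have [t tf] : exists t, t \notin codom f.
  apply/existsP; apply: contra_notT fi => /existsPn tf.
  apply/injectiveP; rewrite /injectiveb /dinjectiveb; apply/card_uniqP.
  rewrite size_map -cardE; apply: eq_card => t.
  by have := tf t; rewrite negbK => ->.
by rewrite (bigD1 t) //= (negPf tf) oppr0 mul0r.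
Qed.

Lemma sum_injective_ffun (G : ('I_k -> 'I_k) -> C) :
  (forall f g, f =1 g -> G f = G g) ->
  \sum_(f : {ffun 'I_k -> 'I_k}) (injectiveb f)%:R * G f = \sum_(s : 'S_k) G s.
Proof.
move=> Gext; rewrite (bigID (fun f : {ffun _} => injectiveb f)) /=.
rewrite [X in _ + X]big1 ?addr0 => [|f /negPf->]; last by rewrite mul0r.
rewrite (reindex (fun s : 'S_k => pval s)) /=; last first.
  (* The inverse map defaults to the identity on non-injective functions, which lie outside the
     range of the sum. *)
  exists (insubd (1%g : 'S_k)) => [s _|f fi]; first by rewrite /= valKd.
  by rewrite insubdK.
rewrite (eq_bigl xpredT) => [|s]; last by rewrite (valP s).
apply: eq_bigr => s _; rewrite (valP s) mul1r.
by apply: Gext => m; rewrite -pvalE.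
Qed.

(** Ryser's inclusion-exclusion formula for the permanent. Applied to matrix entries, it writes a
    symmetrized tensor product as a combination of tensor powers. *)
Lemma ryser (y : 'I_k -> 'I_k -> C) :
  \sum_(s : 'S_k) \prod_m y (s m) m =
  (-1) ^+ k * \sum_(e : {ffun 'I_k -> bool})
     (\prod_t (-1) ^+ e t) * \prod_m \sum_t (e t)%:R * y t m.
Proof.
rewrite -(sum_injective_ffun (G := fun f => \prod_m y (f m) m)); last first.
  by move=> f g fg; apply: eq_bigr => m _; rewrite fg.
under [in RHS]eq_bigr => e _ do rewrite bigA_distr_bigA /= mulr_sumr.
rewrite exchange_big /= mulr_sumr; apply: eq_bigr => f _.
transitivity ((-1) ^+ k * ((-1) ^+ k * (injectiveb f)%:R * \prod_m y (f m) m) : C).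
  by rewrite !mulrA -expr2 sqrr_sign mul1r.
rewrite -ryser_sign mulr_suml; congr (_ * _); apply: eq_bigr => e _.
rewrite !big_split /= -!mulrA; congr (_ * (_ * _)).
(* Both indicator products say that [e] holds on the whole range of [f]. *)
case: (boolP [forall m, e (f m)]) => [/forallP ef|/forallPn [m mf]].
  rewrite !big1 // => [m _|t _]; first by rewrite ef.
  case: (boolP (t \in codom f)) => [/codomP [m ->]|]; first by rewrite ef.
  by rewrite orbT.
rewrite [LHS](bigD1 (f m)) // [RHS](bigD1 m) //= (negPf mf) codom_f.
by rewrite !mul0r.
Qed.
End Polarization.

(** * Schur-Weyl duality *)

Section Commutant.
Variables (C : numClosedFieldType) (k d : nat).
Local Notation T := (tidx k d).
Local Notation op := (T -> T -> C).
Local Notation adjmx A := (map_mx Num.conj A^T).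
Implicit Types (B K : op) (X Y : 'M[C]_d).

Definition op_comm B K :=
  forall i j, \sum_l B i l * K l j = \sum_l K i l * B l j.

Definition tpow X : op := fun i j => \prod_m X (i m) (j m).

Lemma op_comm_sum B (I : finType) (c : I -> C) (K : I -> op) :
  (forall x, op_comm B (K x)) -> op_comm B (fun i j => \sum_x c x * K x i j).
Proof.
move=> BK i j; under eq_bigr => l _ do rewrite mulr_sumr.
under [in RHS]eq_bigr => l _ do rewrite mulr_suml.
rewrite exchange_big [RHS]exchange_big; apply: eq_bigr => x _ /=.
under eq_bigr => l _ do rewrite mulrCA.
under [in RHS]eq_bigr => l _ do rewrite -mulrA.
by rewrite -!mulr_sumr BK.
Qed.

Lemma op_comm_ext B K K' : (forall i j, K i j = K' i j) ->
  op_comm B K -> op_comm B K'.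
Proof.
move=> KK' BK i j; rewrite -(eq_bigr _ (fun l _ => congr1 _ (KK' l j))) BK.
by apply: eq_bigr => l _; rewrite KK'.
Qed.

Definition omul (A B : op) : op := fun i j => \sum_l A i l * B l j.

Lemma op_commE B K : op_comm B K <-> omul B K = omul K B.
Proof.
split=> [BK|E i j]; first by apply/funext => i; apply/funext => j; exact: BK.
exact: (congr1 (fun A : op => A i j) E).
Qed.

Lemma omulA A B K : omul A (omul B K) = omul (omul A B) K.
Proof.
apply/funext => i; apply/funext => j; rewrite /omul.
under eq_bigr => l _ do rewrite mulr_sumr.
rewrite exchange_big; apply: eq_bigr => l _ /=; rewrite mulr_suml.
by apply: eq_bigr => a _; rewrite mulrA.
Qed.

Lemma tpowM X Y : tpow (X *m Y) = omul (tpow X) (tpow Y).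
Proof.
apply/funext => i; apply/funext => j.
rewrite /tpow /omul; under eq_bigr => m _ do rewrite mxE.
by rewrite bigA_distr_bigA; apply: eq_bigr => l _; rewrite big_split.
Qed.

Lemma op_comm_tpowM B X Y :
  op_comm B (tpow X) -> op_comm B (tpow Y) -> op_comm B (tpow (X *m Y)).
Proof.
move=> /op_commE BX /op_commE BY; apply/op_commE.
by rewrite tpowM omulA BX -omulA BY omulA.
Qed.

Lemma tpow1 i j : tpow 1%:M i j = (i == j)%:R.
Proof.
rewrite /tpow; under eq_bigr => m _ do rewrite mxE.
rewrite prod_boolr; congr (_%:R); congr nat_of_bool.
by apply/forallP/eqP => [H|-> //]; apply/ffunP => m; exact/eqP.
Qed.

Lemma omul_tpow1 B : omul B (tpow 1%:M) = B.
Proof.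
apply/funext => i; apply/funext => j; rewrite /omul (bigD1 j) //= tpow1 eqxx mulr1.
by rewrite big1 ?addr0 // => l /negPf lj; rewrite tpow1 lj mulr0.
Qed.

Lemma op_comm_conj B U V : U *m V = 1%:M ->
  op_comm B (tpow U) <-> omul (omul (tpow U) B) (tpow V) = B.
Proof.
move=> UV; split=> [/op_commE BU|E].
  by rewrite -BU -omulA -tpowM UV omul_tpow1.
by apply/op_commE; rewrite -{1}E -omulA -tpowM (mulmx1C UV) omul_tpow1.
Qed.

Lemma prod_diag_mx (D : 'rV[C]_d) (i j : T) :
  tpow (diag_mx D) i j = (i == j)%:R * \prod_m D 0 (i m).
Proof.
rewrite /tpow; case: (eqVneq i j) => [->|ij].
  by rewrite mul1r; apply: eq_bigr => m _; rewrite mxE eqxx.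
have [m ijm] : exists m, i m != j m.
  apply/existsP; apply: contraR ij => /existsPn e; apply/eqP/ffunP => m.
  by have := e m; rewrite negbK => /eqP.
by rewrite (bigD1 m) //= mxE (negPf ijm) mul0r mul0r.
Qed.

Lemma op_comm_tpow_diag B (D : 'rV[C]_d) : op_comm B (tpow (diag_mx D)) <->
  forall i j, B i j * \prod_m D 0 (j m) = (\prod_m D 0 (i m)) * B i j.
Proof.
have E i j : \sum_l B i l * tpow (diag_mx D) l j = B i j * \prod_m D 0 (j m).
  rewrite (bigD1 j) //= big1 ?addr0 => [|l lj].
    by rewrite prod_diag_mx eqxx mul1r.
  by rewrite prod_diag_mx (negPf lj) mul0r mulr0.
have E' i j : \sum_l tpow (diag_mx D) i l * B l j = (\prod_m D 0 (i m)) * B i j.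
  rewrite (bigD1 i) //= big1 ?addr0 => [|l lj].
    by rewrite prod_diag_mx eqxx mul1r.
  by rewrite prod_diag_mx eq_sym (negPf lj) !mul0r.
by split=> H i j; have := H i j; rewrite E E'.
Qed.

(** The polynomial X^n - 1 splits and is separable in characteristic 0, so it has n distinct roots,
    one of which must be primitive. *)
Lemma exists_prim_root n : (0 < n)%N -> exists z : C, n.-primitive_root z.
Proof.
pose p : {poly C} := 'X^n - 1; have [s Dp] := closed_field_poly_normal p.
move=> n0; rewrite (monicP _) ?monicXnsubC // scale1r in Dp.
have sn1 : all n.-unity_root s by apply/allP=> z; rewrite -root_prod_XsubC -Dp.
have sz_s : (n < (size s).+1)%N.
  by rewrite -(size_prod_XsubC s id) -Dp size_XnsubC.
have [|z] := hasP (has_prim_root n0 sn1 _ sz_s); last by exists z.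
by rewrite -separable.separable_prod_XsubC -Dp separable_Xn_sub_1 // pnatr_eq0 -lt0n.
Qed.

Section UnitaryInvariant.
Variable B : op.
Hypothesis Bunitary : forall U, U *m adjmx U = 1%:M -> op_comm B (tpow U).

(* Conjugating by diag(1,..,z,..,1) with z a primitive root of unity of large
   order shows that B only links multi-indices with equal content. *)
Lemma content_preserving i j (a : 'I_d) : B i j != 0 ->
  #|[pred m | i m == a]| = #|[pred m | j m == a]|.
Proof.
(* Contents lie between 0 and k, so powers of a root of order k+1 tell them apart. *)
move=> Bij; have [z zP] := exists_prim_root (ltn0Sn k).
have z1 : `|z| = 1.
  apply/eqP; rewrite -(@pexpr_eq1 _ _ k.+1) //.
  by rewrite -normrX prim_expr_order ?normr1.
pose D : 'rV[C]_d := \row_b (if b == a then z else 1).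
have DU : diag_mx D *m adjmx (diag_mx D) = 1%:M.
  apply/matrixP=> x y; rewrite mul_diag_mx !mxE; case: (eqVneq y x) => [->|_].
    by rewrite !mulr1n -normCK; case: (x == a); rewrite ?z1 ?normr1 expr1n.
  by rewrite !mulr0n rmorph0 mulr0.
have prodD (x : T) : \prod_m D 0 (x m) = z ^+ #|[pred m | x m == a]|.
  rewrite (bigID (fun m => x m == a)) /= [X in _ * X]big1 ?mulr1; last first.
    by move=> m /negPf xm; rewrite mxE xm.
  by rewrite (eq_bigr (fun=> z)) ?prodr_const // => m xm; rewrite mxE xm.
have /op_comm_tpow_diag/(_ i j) := Bunitary DU.
rewrite mulrC => /(mulIf Bij); rewrite !prodD => /eqP.
have lek (x : T) : (#|[pred m | x m == a]| < k.+1)%N.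
  by rewrite ltnS -[X in (_ <= X)%N](card_ord k) max_card.
by rewrite (eq_prim_root_expr zP) !modn_small // => /eqP ->.
Qed.

(** The diagonal entry of the tensor power at a multi-index depends only on its content, which [B]
    preserves. *)
Lemma op_comm_diag (D : 'rV[C]_d) : op_comm B (tpow (diag_mx D)).
Proof.
apply/op_comm_tpow_diag => i j.
case: (eqVneq (B i j) 0) => [->|Bij]; first by rewrite mul0r mulr0.
rewrite mulrC; congr (_ * _).
have E (x : T) : \prod_m D 0 (x m) = \prod_a D 0 a ^+ #|[pred m | x m == a]|.
  rewrite (partition_big x xpredT) //=; apply: eq_bigr => a _.
  by rewrite (eq_bigr (fun=> D 0 a)) ?prodr_const // => m /eqP->.
by rewrite !E; apply: eq_bigr => a _; rewrite (content_preserving a Bij).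
Qed.

Lemma op_comm_hermitian X : adjmx X = X -> op_comm B (tpow X).
Proof.
move=> XH; have /hermitian_normalmx/orthomx_spectralP : X \is hermsymmx.
  by apply/is_hermitianmxP; rewrite expr0 scale1r XH.
have Pu := spectral_unitarymx X; have := Pu; rewrite -trmxC_unitary => Pu'.
rewrite (invmx_unitary Pu) => ->.
by do !apply: op_comm_tpowM;
  try exact: op_comm_diag; apply: Bunitary; apply/unitarymxP.
Qed.

Lemma poly_eq0_nat (p : {poly C}) : (forall n : nat, p.[n%:R] = 0) -> p = 0.
Proof.
move=> p0; apply: (@roots_geq_poly_eq0 _ p [seq n%:R | n <- iota 0 (size p)]).
- by apply/allP => _ /mapP[n _ ->]; rewrite /root p0.
- by rewrite map_inj_uniq ?iota_uniq //; exact: (mulrIn (oner_neq0 C)).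
- by rewrite size_map size_iota.
Qed.

Lemma tpow_poly (A A' : 'M[C]_d) (z : C) (i j : T) :
  (\prod_m ((A (i m) (j m))%:P + 'X * (A' (i m) (j m))%:P)).[z] =
  tpow (A + z *: A') i j.
Proof. by rewrite horner_prod; apply: eq_bigr => m _; rewrite !hornerE !mxE. Qed.

(* A + z A' is hermitian for real z, and commuting with its tensor power is a
   polynomial condition on z, hence it extends to z = i. *)
Lemma op_comm_all X : op_comm B (tpow X).
Proof.
pose A := 2^-1 *: (X + adjmx X); pose A' := (2 * 'i)^-1 *: (X - adjmx X).
have n2 : (2 : C) != 0 by rewrite pnatr_eq0.
have ni : ('i : C) != 0 by exact: neq0Ci.
have -> : X = A + 'i *: A'.
  apply/matrixP=> a b; rewrite !mxE; move: (X a b) (X b a)^* => x y.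
  by field; rewrite ?n2 ?ni.
have AH n : adjmx (A + n%:R *: A') = A + n%:R *: A'.
  apply/matrixP=> a b; rewrite !mxE !(rmorphD, rmorphM, rmorphN) /= !conjCK.
  rewrite !fmorphV rmorphM /= conjCi !rmorph_nat.
  move: (X a b) (X b a)^* => x y.
  by field; rewrite ?n2 ?ni.
pose q (i j : T) : {poly C} := \prod_m ((A (i m) (j m))%:P + 'X * (A' (i m) (j m))%:P).
move=> i j.
pose p : {poly C} := \sum_l (B i l)%:P * q l j - \sum_l q i l * (B l j)%:P.
have pE z : p.[z] = \sum_l B i l * tpow (A + z *: A') l j -
    \sum_l tpow (A + z *: A') i l * B l j.
  rewrite !hornerE !horner_sum; congr (_ - _); apply: eq_bigr => l _;
  by rewrite !hornerE tpow_poly.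
(* At natural [n] the matrix [A + n%:R *: A'] is hermitian, so [p] has infinitely many roots. *)
have p0 : p = 0.
  by apply: poly_eq0_nat => n; rewrite pE (op_comm_hermitian (AH n)) subrr.
by have := pE 'i; rewrite p0 horner0 => /esym/eqP; rewrite subr_eq0 => /eqP.
Qed.

(** By [ryser] this operator is a combination of tensor powers of the partial sums of the [Y t]. *)
Lemma op_comm_sym (Y : 'I_k -> 'M[C]_d) :
  op_comm B (fun i j => \sum_(s : 'S_k) \prod_m Y (s m) (i m) (j m)).
Proof.
pose K (e : {ffun 'I_k -> bool}) := tpow (\sum_t (e t)%:R *: Y t).
pose c (e : {ffun 'I_k -> bool}) : C := (-1) ^+ k * \prod_t (-1) ^+ e t.
apply: op_comm_ext (op_comm_sum c (fun e => op_comm_all _) : op_comm B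
  (fun i j => \sum_e c e * K e i j)) => i j.
rewrite (ryser (fun t m => Y t (i m) (j m))) mulr_sumr; apply: eq_bigr => e _.
rewrite mulrA; congr (_ * _); apply: eq_bigr => m _.
by rewrite summxE; apply: eq_bigr => t _; rewrite mxE.
Qed.

(** The permutation operator of [s] has entry 1 at [(i, j)] exactly when [j = tact i s]. *)
Definition tact (x : T) (s : 'S_k) : T := [ffun m => x (s m)].

(** Symmetrizing a product of matrix units gives the sum of the matrix units over the simultaneous
    orbit of [(b, c)]. *)
Lemma op_comm_orbit (b c : T) : op_comm B (fun i j =>
  \sum_(s : 'S_k) (i == tact b s)%:R * (j == tact c s)%:R).
Proof.
apply: op_comm_ext (op_comm_sym (fun t => delta_mx (b t) (c t))) => i j.
apply: eq_bigr => s _; rewrite -natrM mulnb.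
rewrite (eq_bigr (fun m => ((i m == b (s m)) && (j m == c (s m)))%:R)); last first.
  by move=> m _; rewrite mxE.
rewrite prod_boolr; congr (_ %:R); congr nat_of_bool.
apply/forallP/andP => [ij|[/eqP-> /eqP->] m]; last by rewrite !ffunE !eqxx.
by split; apply/eqP/ffunP=> m; rewrite ffunE; have /andP[/eqP ? /eqP ?] := ij m.
Qed.

Lemma tactK s x : tact (tact x s) s^-1%g = x.
Proof. by apply/ffunP => m; rewrite !ffunE permKV. Qed.

Lemma tactVK s x : tact (tact x s^-1%g) s = x.
Proof. by apply/ffunP => m; rewrite !ffunE permK. Qed.

Lemma tact_inj s : injective (tact^~ s).
Proof. by apply: (@can_inj _ _ _ (tact^~ s^-1%g)) => x; rewrite tactK. Qed.

(* The coefficients c_s = tr (phi T(s) B) satisfy sum_s c_s T(s^-1) = 0, so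
   sum_s |c_s|^2 = 0. *)
Lemma double_commutant (phi : op) :
  (forall s, \sum_x phi x (tact x s) = 0) -> \sum_x \sum_y phi x y * B y x = 0.
Proof.
move=> phi0; pose c (s : 'S_k) := \sum_x \sum_j phi j x * B (tact x s) j.
(* After expanding [c], [op_comm_orbit] moves [B] to the other side of an orbit sum; what remains is
   [phi] paired with permutation operators, zero by [phi0]. *)
have cE i b : \sum_(s : 'S_k) (i == tact b s)%:R * c s = 0.
  transitivity (\sum_x \sum_j phi j x * \sum_l
     (\sum_(s : 'S_k) (i == tact b s)%:R * (l == tact x s)%:R) * B l j).
    rewrite /c; under eq_bigr => s _ do rewrite mulr_sumr.
    rewrite exchange_big; apply: eq_bigr => x _ /=.
    under eq_bigr => s _ do rewrite mulr_sumr.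
    rewrite exchange_big; apply: eq_bigr => j _ /=.
    under [in RHS]eq_bigr => l _ do rewrite mulr_suml.
    rewrite exchange_big /= mulr_sumr; apply: eq_bigr => s _ /=.
    rewrite (bigD1 (tact x s)) //= big1 ?addr0 => [|l /negPf ->].
      by rewrite eqxx mulr1 mulrCA.
    by rewrite mulr0 mul0r.
  under eq_bigr => x _ do under eq_bigr => j _ do
    rewrite -(op_comm_orbit b x i j) mulr_sumr.
  transitivity (\sum_(s : 'S_k) \sum_l B i l * (l == tact b s)%:R *
      \sum_x phi (tact x s) x).
    under [in RHS]eq_bigr => s _ do under eq_bigr => l _ do rewrite mulr_sumr.
    rewrite [RHS]exchange_big /=.
    under [in RHS]eq_bigr => l _ do rewrite exchange_big.
    rewrite [RHS]exchange_big; apply: eq_bigr => x _ /=.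
    rewrite exchange_big; apply: eq_bigr => l _ /=.
    under eq_bigr => j _ do rewrite !mulr_sumr.
    rewrite exchange_big; apply: eq_bigr => s _ /=.
    rewrite (bigD1 (tact x s)) //= big1 ?addr0 => [|j /negPf ->].
      by rewrite eqxx mulr1 mulrC.
    by rewrite !mulr0.
  apply: big1 => s _; apply: big1 => l _.
  rewrite (reindex_inj (@tact_inj s^-1%g)) /=.
  under eq_bigr => x _ do rewrite tactVK.
  by rewrite phi0 mulr0.
(* Expanding one factor [c s] leaves an inner sum that is the conjugate of [cE]. Hence all [c s]
   vanish, and [c 1%g] is the sum wanted. *)
have ccE : \sum_(s : 'S_k) (c s)^* * c s = 0.
  transitivity (\sum_x \sum_j \sum_i phi j x * B i j *
     \sum_(s : 'S_k) (i == tact x s)%:R * (c s)^*).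
    rewrite {2}/c; under eq_bigr => s _ do rewrite mulr_sumr.
    rewrite exchange_big; apply: eq_bigr => x _ /=.
    under eq_bigr => s _ do rewrite mulr_sumr.
    rewrite exchange_big; apply: eq_bigr => j _ /=.
    under [in RHS]eq_bigr => i _ do rewrite mulr_sumr.
    rewrite exchange_big; apply: eq_bigr => s _ /=.
    rewrite (bigD1 (tact x s)) //= big1 ?addr0 => [|l /negPf ->].
      by rewrite eqxx mul1r mulrC.
    by rewrite mul0r mulr0.
  apply: big1 => x _; apply: big1 => j _; apply: big1 => i _.
  have -> : \sum_(s : 'S_k) (i == tact x s)%:R * (c s)^* =
      (\sum_(s : 'S_k) (i == tact x s)%:R * c s)^*.
    by rewrite rmorph_sum; apply: eq_bigr => s _; rewrite rmorphM /= rmorph_nat.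
  by rewrite cE rmorph0 mulr0.
have /eqP c1 : c 1%g == 0.
  move/eqP: ccE; rewrite psumr_eq0 => [/allP/(_ 1%g (mem_index_enum _))/=|s _].
    by rewrite mulf_eq0 conjC_eq0 orbb.
  by rewrite mulrC mul_conjC_ge0.
rewrite -[RHS]c1 /c exchange_big; apply: eq_bigr => x _; apply: eq_bigr => j _.
by congr (_ * B _ _); apply/ffunP => m; rewrite ffunE perm1.
Qed.

(** Operators are flattened to row vectors, the permutation operators being the rows of [M]. Columns
    of [cokermx M] are functionals killing these rows, so by [double_commutant] they kill [B], which
    puts [B] in the row space. *)
Lemma schur_weyl : exists alpha : {ffun 'S_k -> C}, forall i j,
  B i j = \sum_(s : 'S_k) alpha s * ([forall m, i m == j (s^-1%g m)])%:R.
Proof.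
pose P (s : 'S_k) (q : T * T) : C := ([forall m, q.1 m == q.2 (s^-1%g m)])%:R.
pose M : 'M[C]_(#|'S_k|, #|{: T * T}|) := \matrix_(p, q) P (enum_val p) (enum_val q).
pose v : 'rV[C]_(#|{: T * T}|) := \row_q B (enum_val q).1 (enum_val q).2.
have PE s x y : P s (x, y) = (x == tact y s^-1%g)%:R.
  rewrite /P; congr (_%:R); congr nat_of_bool => /=.
  by apply/forallP/eqP => [H|-> m]; [apply/ffunP=> m|]; rewrite ffunE // (eqP (H m)).
have : (v <= M)%MS.
  rewrite submxE; apply/eqP/rowP => l.
  pose phi x y : C := cokermx M (enum_rank (y, x)) l.
  have -> : (v *m cokermx M) 0 l = \sum_x \sum_y phi x y * B y x.
    rewrite exchange_big pair_bigA /= mxE (reindex enum_rank) /=; last first.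
      exact: onW_bij (enum_rank_bij _).
    apply: eq_bigr => -[x y] _; rewrite mxE enum_rankK mulrC; exact.
  rewrite mxE; apply: double_commutant => s.
  (* The row of the inverse is the one supported on the pairs [(tact x s, x)]. *)
  have /matrixP/(_ (enum_rank s^-1%g) l) := mulmx_coker M.
  rewrite [in X in _ = X]mxE => H; rewrite -[RHS]H mxE (reindex enum_rank) /=; last first.
    exact: onW_bij (enum_rank_bij _).
  pose F y x := M (enum_rank s^-1%g) (enum_rank (y, x)) * phi x y.
  transitivity (\sum_y \sum_x F y x); last first.
    by rewrite pair_bigA; apply: eq_bigr => -[x y].
  rewrite exchange_big /F /=.
  apply: eq_bigr => x _; rewrite (bigD1 (tact x s)) //= big1 ?addr0 => [|y yx].
    by rewrite mxE !enum_rankK PE invgK eqxx mul1r.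
  by rewrite mxE !enum_rankK PE invgK (negPf yx) mul0r.
case/submxP => u vE; exists [ffun s => u 0 (enum_rank s)] => i j.
have /rowP/(_ (enum_rank (i, j))) := vE; rewrite !mxE enum_rankK /= => ->.
rewrite (reindex enum_rank) /=; last exact: onW_bij (enum_rank_bij _).
by apply: eq_bigr => s _; rewrite ffunE mxE !enum_rankK.
Qed.
End UnitaryInvariant.
End Commutant.

(** * Traces of cycles *)

Section Multilinear.
Variables (F : comNzRingType) (I : finType) (d : nat).
Implicit Types (X Y : I -> 'M[F]_d) (G H : (I -> 'M[F]_d) -> F).

Definition upd X t (A : 'M[F]_d) : I -> 'M[F]_d :=
  fun u => if u == t then A else X u.

Definition mlin G := forall X t a A B,
  G (upd X t (a *: A + B)) = a * G (upd X t A) + G (upd X t B).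

Definition lin (phi : 'M[F]_d -> F) :=
  forall a A B, phi (a *: A + B) = a * phi A + phi B.

(** Spanning in dual form, ready to be applied to a multilinear function with all slots but one
    frozen. *)
Definition spans (S : 'M[F]_d -> Prop) := forall phi, lin phi ->
  (forall A, S A -> phi A = 0) -> forall A, phi A = 0.

Lemma upd_id X t : upd X t (X t) = X.
Proof. by apply/funext => u; rewrite /upd; case: eqP => [->|]. Qed.

Lemma lin0 phi : lin phi -> phi 0 = 0.
Proof.
move=> L; have := L 1 0 0; rewrite scaler0 addr0 mul1r.
by move/(congr1 (fun x => x - phi 0)); rewrite addrK subrr.
Qed.

Lemma linZ phi a A : lin phi -> phi (a *: A) = a * phi A.
Proof. by move=> L; rewrite -[X in phi X]addr0 L (lin0 L) addr0. Qed.

Lemma linD phi A B : lin phi -> phi (A + B) = phi A + phi B.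
Proof. by move=> L; rewrite -{1}[A]scale1r L mul1r. Qed.

Lemma linB phi A B : lin phi -> phi (A - B) = phi A - phi B.
Proof. by move=> L; rewrite (linD _ _ L) -scaleN1r (linZ _ _ L) mulN1r. Qed.

(** Slots are freed one at a time: the induction is on a list [s] of slots holding arbitrary
    matrices, the others staying in [S]. *)
Lemma mlin_ext S G H : mlin G -> mlin H -> spans S ->
  (forall X, (forall t, S (X t)) -> G X = H X) -> forall X, G X = H X.
Proof.
move=> Gl Hl Ssp GH.
have main (s : seq I) X : (forall t, t \notin s -> S (X t)) -> G X = H X.
  elim: s X => [|t s IH] X SX; first by apply: GH => t; exact: SX.
  apply/eqP; rewrite -(upd_id X t) -subr_eq0; apply/eqP; move: (X t).
  apply: (Ssp (fun A => G (upd X t A) - H (upd X t A))) => [a A B|A SA].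
    by rewrite Gl Hl mulrBr opprD addrACA.
  apply/eqP; rewrite subr_eq0; apply/eqP; apply: IH => u us.
  rewrite /upd; case: eqVneq => // ut.
  by apply: SX; rewrite inE negb_or ut.
by move=> X; apply: (main (enum I)) => t; rewrite mem_enum.
Qed.

Lemma mlin_const_mul a G : mlin G -> mlin (fun X => a * G X).
Proof. by move=> Gl X t b A B; rewrite Gl mulrDr mulrCA. Qed.

Lemma mlin_bigsum (J : finType) (G : J -> (I -> 'M[F]_d) -> F) :
  (forall j, mlin (G j)) -> mlin (fun X => \sum_j G j X).
Proof.
move=> Gl X t a A B; rewrite mulr_sumr -big_split.
by apply: eq_bigr => j _; rewrite Gl.
Qed.

Lemma mlin_entries (f g : I -> 'I_d) : mlin (fun X => \prod_t X t (f t) (g t)).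
Proof.
move=> X t a A B.
have E Z : \prod_u upd X t Z u (f u) (g u) =
    Z (f t) (g t) * \prod_(u | u != t) X u (f u) (g u).
  rewrite (bigD1 t) //= /upd eqxx; congr (_ * _).
  by apply: eq_bigr => u /negPf->.
by rewrite !E !mxE mulrDl mulrA.
Qed.

Lemma prod_upd_notin X t A (w : seq I) : t \notin w ->
  \prod_(u <- w) upd X t A u = \prod_(u <- w) X u.
Proof.
move=> tw; apply: eq_big_seq => u uw; rewrite /upd; case: eqVneq => // ut.
by rewrite -ut uw in tw.
Qed.

Lemma mlin_traces (cs : seq (seq I)) :
  uniq (flatten cs) -> (forall t, t \in flatten cs) ->
  mlin (fun X => \prod_(c <- cs) \tr (\prod_(u <- c) X u)).
Proof.
move=> Ucs Acs X t a A B; have /flattenP [c ccs tc] := Acs t.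
case/splitPr: ccs Ucs => cs1 cs2; case/splitPr: tc => c1 c2.
rewrite flatten_cat /= => U.
(* Moving [t] to the front shows that it occurs nowhere else, so an update at [t] touches one factor
   of one trace. *)
have {U} U : uniq (t :: (flatten cs1 ++ c1 ++ c2 ++ flatten cs2)).
  rewrite -(perm_uniq (s1 := flatten cs1 ++ (c1 ++ t :: c2) ++ flatten cs2)) //.
  by apply/seq.permP => q; rewrite /= !count_cat /=; ring.
have := U; rewrite /= !mem_cat !negb_or => /andP[/and4P[t1 t2 t3 t4] _].
have cs_upd (cs' : seq (seq I)) Z : t \notin flatten cs' ->
    \prod_(c <- cs') \tr (\prod_(u <- c) upd X t Z u) =
    \prod_(c <- cs') \tr (\prod_(u <- c) X u).
  move=> tcs; apply: eq_big_seq => c' c'cs; rewrite prod_upd_notin //.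
  by apply: contra tcs => tc'; apply/flattenP; exists c'.
rewrite !big_cat /= !big_cons /= !cs_upd //.
have tr_upd Z : \tr (\prod_(u <- c1 ++ t :: c2) upd X t Z u) =
    \tr ((\prod_(u <- c1) X u) *m Z *m (\prod_(u <- c2) X u)).
  by rewrite big_cat big_cons /= !prod_upd_notin // /upd eqxx -mulmxA.
rewrite !tr_upd mulmxDr mulmxDl mxtraceD -scalemxAr -scalemxAl mxtraceZ.
by rewrite mulrDl mulrDr -mulrA mulrCA.
Qed.

Lemma spans_delta : spans (fun A => exists ij, A = delta_mx ij.1 ij.2).
Proof.
move=> phi L phi0 A; rewrite (matrix_sum_delta A) pair_bigA /=.
elim/big_rec: _ => [|ij B _ phiB]; first exact: lin0.
by rewrite L phiB phi0 ?mulr0 ?addr0 //; exists ij.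
Qed.
End Multilinear.

(** * Permutations and their cycles *)

Section CycleFormula.
Variables (I : finType).
Implicit Types (c : seq I) (cs : seq (seq I)).

(** [s] runs backwards along each list: in a product of matrices the column index at [x] is the row
    index at the next letter. *)
Definition perm_cycles (s : {perm I}) cs :=
  forall c x, c \in cs -> x \in c -> s (next c x) = x.

Lemma cycle_uniqE (e : rel I) c :
  uniq c -> path.cycle e c = all (fun x => e x (next c x)) c.
Proof.
move=> Uc; apply/idP/allP => [ec x xc|]; first exact: next_cycle.
exact: cycle_from_next.
Qed.

Lemma flatten_uniq_mem cs c : uniq (flatten cs) -> c \in cs -> uniq c.
Proof.
elim: cs => //= b cs IH; rewrite cat_uniq inE => /and3P[Ub _ Ucs].
by case/predU1P => [->|] //; exact: IH.
Qed.

Lemma flatten_uniq_inj cs c c' x : uniq (flatten cs) ->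
  c \in cs -> c' \in cs -> x \in c -> x \in c' -> c = c'.
Proof.
elim: cs => //= b cs IH; rewrite cat_uniq !inE => /and3P[_ /hasPn bcs Ucs].
have disj a : a \in cs -> x \in a -> x \in b -> False.
  move=> acs xa xb; have /bcs : x \in flatten cs by apply/flattenP; exists a.
  by rewrite /= xb.
case/predU1P => [->|ccs] /predU1P [->|c'cs] // xc xc'.
- by case: (disj _ c'cs xc' xc).
- by case: (disj _ ccs xc xc').
- exact: IH.
Qed.

(** Each letter lies in exactly one list, so its successor there is well defined, and [prev] makes
    this map injective. Its inverse has the required orientation. *)
Lemma perm_of_cycles cs : uniq (flatten cs) -> (forall x, x \in flatten cs) ->
  exists s, perm_cycles s cs.
Proof.
move=> Ucs Acs; pose cyc x := nth [::] cs (find (fun c => x \in c) cs).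
have hcs x : has (fun c => x \in c) cs.
  by have /flattenP [c ccs xc] := Acs x; apply/hasP; exists c.
have cyc_mem x : cyc x \in cs by rewrite mem_nth // -has_find.
have mem_cyc x : x \in cyc x := nth_find [::] (hcs x).
pose f x := next (cyc x) x.
have f_cyc x : f x \in cyc x by rewrite mem_next.
have f_inj : injective f.
  move=> x y fxy; have cxy : cyc x = cyc y.
    by apply: (flatten_uniq_inj Ucs _ _ (f_cyc x)); rewrite // fxy.
  have := fxy; rewrite /f cxy => /(congr1 (prev (cyc y))).
  by rewrite !prev_next // (flatten_uniq_mem Ucs).
exists (perm f_inj)^-1%g => c x ccs xc; rewrite -[RHS](permK (perm f_inj)) permE.
by rewrite /f (flatten_uniq_inj Ucs (cyc_mem x) ccs (mem_cyc x) xc).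
Qed.

(** Strong induction on the size of [S], removing one orbit: connectedness under an injective [f] is
    symmetric, so the rest is still stable. *)
Lemma fcycles_of_inj (f : I -> I) (S : {set I}) : injective f ->
  (forall x, x \in S -> f x \in S) ->
  exists cs, [/\ uniq (flatten cs), flatten cs =i S, [::] \notin cs &
    forall c, c \in cs -> fcycle f c].
Proof.
move=> fI; have [n] := ubnP #|S|; elim: n S => // n IH S Sn Sf.
have [->|[x xS]] := set_0Vmem S; first by exists [::]; split=> // y; rewrite inE.
have orbS y : y \in fingraph.orbit f x -> y \in S.
  rewrite -fconnect_orbit => /iter_findex <-.
  by elim: (findex _ _ _) => //= m; exact: Sf.
have [||cs [Ucs Ecs Ncs Fcs]] := IH (S :\: [set y in fingraph.orbit f x]).
- rewrite -ltnS (leq_trans _ Sn) // ltnS; apply: proper_card.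
  apply/properP; split; first exact: subsetDl.
  by exists x => //; rewrite !inE -fconnect_orbit connect0.
- move=> y; rewrite !inE => /andP[yx yS]; rewrite Sf // andbT.
  apply: contra yx; rewrite -!fconnect_orbit => /connect_trans; apply.
  by rewrite fconnect_sym // fconnect1.
exists (fingraph.orbit f x :: cs); split => /=.
- rewrite cat_uniq orbit_uniq Ucs andbT /=; apply/hasPn => y.
  by rewrite Ecs !inE => /andP[].
- move=> y; rewrite mem_cat Ecs !inE.
  by case: (boolP (y \in fingraph.orbit f x)) => [/orbS ->|].
- rewrite inE negb_or Ncs andbT eq_sym -size_eq0 size_orbit.
  by rewrite -lt0n fingraph.order_gt0.
- by move=> c; rewrite inE => /predU1P[->|/Fcs //]; exact: cycle_orbit.
Qed.

Lemma cycles_of_perm (s : {perm I}) (t : I) : exists c cs,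
  [/\ uniq (flatten (rcons c t :: cs)), forall x, x \in flatten (rcons c t :: cs),
      [::] \notin cs & perm_cycles s (rcons c t :: cs)].
Proof.
pose f := (s^-1)%g; have fI : injective f := @perm_inj _ f.
have [|cs [Ucs Ecs Ncs Fcs]] := @fcycles_of_inj f (~: [set y in fingraph.orbit f t]) fI.
  move=> y; rewrite !inE; apply: contra; rewrite -!fconnect_orbit => /connect_trans.
  by apply; rewrite fconnect_sym // fconnect1.
(* The orbit starts at [t]; one rotation puts [t] last, where the variable multiplying the untraced
   word will stand. *)
have [c Ec] : exists c, rcons c t = rot 1%N (fingraph.orbit f t).
  exists (behead (fingraph.orbit f t)); rewrite /fingraph.orbit -fingraph.orderSpred /=.
  by rewrite rot1_cons.
have Forb : fcycle f (rcons c t) by rewrite Ec rot_cycle; exact: cycle_orbit.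
exists c, cs; split => //=.
- rewrite cat_uniq Ec rot_uniq orbit_uniq Ucs andbT /=; apply/hasPn => y.
  by rewrite Ecs !inE mem_rot.
- by move=> y; rewrite mem_cat Ecs !inE Ec mem_rot; case: (_ \in _).
- move=> b x; rewrite inE => bcs xb.
  have Fb : fcycle f b by case/predU1P: bcs => [->|/Fcs].
  by have /eqP <- := next_cycle Fb xb; rewrite permKV.
Qed.

Variables (F : comNzRingType) (d : nat).

(** Consecutive matrix units multiply to zero unless their inner indices agree, and the trace closes
    the loop. The empty word would give [d]. *)
Lemma trace_prod_delta (a b : I -> 'I_d) c : c != [::] ->
  \tr (\prod_(u <- c) delta_mx (a u) (b u) : 'M[F]_d) =
  (path.cycle (fun x y => b x == a y) c)%:R.
Proof.
case: c => // x c _; pose e : rel I := fun x y => b x == a y.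
rewrite -[path.cycle _ _]/(path e x (rcons c x)).
have -> : \prod_(u <- x :: c) delta_mx (a u) (b u) =
    (path e x c)%:R *: delta_mx (a x) (b (last x c)) :> 'M[F]_d.
  elim: c x => [|y c IH] x; first by rewrite big_seq1 scale1r.
  rewrite big_cons IH -[_ * _]/(_ *m _) -scalemxAr /= mul_delta_mx_cond /e.
  by case: (b x == a y); rewrite ?mulr1n //= mulr0n scaler0 scale0r.
rewrite mxtraceZ rcons_path -mulnb natrM; congr (_ * _).
rewrite /mxtrace (bigD1 (a x)) //= big1 ?addr0 => [|i /negPf ia].
  by rewrite mxE eqxx /= /e eq_sym.
by rewrite mxE ia.
Qed.

Lemma prod_all (J : eqType) (q : J -> bool) (l : seq J) :
  \prod_(x <- l) (q x)%:R = (all q l)%:R :> F.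
Proof.
by elim: l => [|x l IH]; rewrite ?big_nil // big_cons IH -natrM mulnb.
Qed.

(* Both sides are multilinear in X, so it suffices to compare them on matrix
   units, where each side is 0 or 1. *)
Lemma cycle_formula (s : {perm I}) cs (X : I -> 'M[F]_d) :
  uniq (flatten cs) -> (forall x, x \in flatten cs) -> [::] \notin cs ->
  perm_cycles s cs ->
  \sum_(i : {ffun I -> 'I_d}) \prod_t X t (i (s t)) (i t) =
  \prod_(c <- cs) \tr (\prod_(u <- c) X u).
Proof.
move=> Ucs Acs Ncs scs; move: X; apply: mlin_ext (@spans_delta F d) _.
- by apply: mlin_bigsum => i; exact: mlin_entries.
- exact: mlin_traces.
move=> X /choice [ab abE].
have {abE} -> : X = fun t => delta_mx (ab t).1 (ab t).2 by exact/funext.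
set a := fun t => (ab t).1; set b := fun t => (ab t).2.
(* The column indices of the matrix units leave only the summand [i = b]. *)
transitivity ([forall t, a t == b (s t)]%:R : F).
  rewrite (bigD1 (finfun b)) //= [X in _ + X]big1 ?addr0 => [|i ib].
    by rewrite -prod_boolr; apply: eq_bigr => t _; rewrite mxE !ffunE eqxx andbT eq_sym.
  have [t /negPf it] : exists t, i t != b t.
    apply/existsP; apply: contraR ib => /existsPn e; apply/eqP/ffunP => t.
    by rewrite ffunE; have := e t; rewrite negbK => /eqP.
  by rewrite (bigD1 t) //= mxE it andbF mul0r.
(* Substituting the inverse image of [x] for [t] gives the matching condition along cycles. *)
have -> : [forall t, a t == b (s t)] = all (fun x => b x == a (s^-1%g x)) (flatten cs).
  apply/forallP/allP => [H x _|H t].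
    by rewrite -{1}(permKV s x) eq_sym.
  by rewrite -{1}(permK s t) eq_sym; apply: H.
rewrite -prod_all big_flatten; apply: eq_big_seq => c ccs.
rewrite trace_prod_delta; last by apply: contra Ncs => /eqP <-.
rewrite cycle_uniqE ?(flatten_uniq_mem Ucs) // -prod_all.
apply: eq_big_seq => x xc.
by rewrite -{2}(scs c x ccs xc) permK.
Qed.
End CycleFormula.

(** * Trace polynomials and permutation operators *)

Section Pairing.
Variables (F : comNzRingType) (d : nat).

(* Over F = R[i], convertible to [top_tr (top_mul B (tens Z))]; likewise [pfun],
   [teval] and [tperm_comb] below are [fB], [tp_eval] and [That]. *)
Definition tpair k (B : tidx k d -> tidx k d -> F) (Z : 'I_k -> 'M[F]_d) : F :=
  \sum_i \sum_l B i l * \prod_m Z m (l m) (i m).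

(** Generalizes [extX], whose last slot is the identity, so that the partial trace can be tested
    against any [Y]. *)
Definition ext r (X : 'I_r -> 'M[F]_d) (Y : 'M[F]_d) (m : 'I_r.+1) : 'M[F]_d :=
  if unlift ord_max m is Some m' then X m' else Y.

Definition pfun r (B : tidx r.+1 d -> tidx r.+1 d -> F) (X : 'I_r -> 'M[F]_d) :
    'M[F]_d :=
  \matrix_(a, b) \sum_(i : tidx r.+1 d | i ord_max == a)
    \sum_l B i l * \prod_m ext X 1%:M m (l m)
      ([ffun m => if m == ord_max then b else i m] m).

Lemma ext_max r (X : 'I_r -> 'M[F]_d) Y : ext X Y ord_max = Y.
Proof. by rewrite /ext unlift_none. Qed.

Lemma ext_lift r (X : 'I_r -> 'M[F]_d) Y m : ext X Y (lift ord_max m) = X m.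
Proof. by rewrite /ext liftK. Qed.

Lemma extE r (Z : 'I_r.+1 -> 'M[F]_d) :
  ext (fun m => Z (lift ord_max m)) (Z ord_max) = Z.
Proof.
by apply/funext => m; case: (unliftP ord_max m) => [m' ->|->];
  rewrite ?ext_lift ?ext_max.
Qed.

Lemma pfunE r (B : tidx r.+1 d -> tidx r.+1 d -> F) (X : 'I_r -> 'M[F]_d) a b :
  pfun B X a b = \sum_(i : tidx r.+1 d | i ord_max == a)
    \sum_l B i l * \prod_m ext X 1%:M m (l m)
      ([ffun m => if m == ord_max then b else i m] m).
Proof. by rewrite mxE. Qed.

Lemma pfun_pair r (B : tidx r.+1 d -> tidx r.+1 d -> F) X Y :
  \tr (pfun B X *m Y) = tpair B (ext X Y).
Proof.
rewrite /tpair (partition_big (fun i : tidx r.+1 d => i ord_max) xpredT) //=.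
rewrite /mxtrace; apply: eq_bigr => a _; rewrite mxE.
under [LHS]eq_bigr => b _ do rewrite pfunE mulr_suml.
rewrite exchange_big; apply: eq_bigr => i /= /eqP ia.
under [LHS]eq_bigr => b _ do rewrite mulr_suml.
rewrite exchange_big; apply: eq_bigr => l _ /=.
(* The identity in the last slot keeps only [b = l ord_max], and the entry of [Y] takes its
   place. *)
rewrite (bigD1 (l ord_max)) //= [X in _ + X]big1 ?addr0 => [|b /negPf bl].
  rewrite -mulrA; congr (_ * _).
  rewrite [in LHS](bigD1_ord ord_max) // [in RHS](bigD1_ord ord_max) //=.
  rewrite !ext_max ffunE eqxx mxE eqxx mul1r mulrC ia; congr (_ * _).
  apply: eq_bigr => m _.
  by rewrite !ext_lift ffunE eq_sym (negPf (neq_lift _ _)).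
rewrite (bigD1_ord ord_max) //= ext_max ffunE eqxx mxE eq_sym bl.
by rewrite mul0r mulr0 mul0r.
Qed.

Lemma mxtrace_mul_ext (A B : 'M[F]_d) :
  (forall Y, \tr (A *m Y) = \tr (B *m Y)) -> A = B.
Proof.
by move=> AB; apply/matrixP => i j; rewrite -!mxtrace_mul_delta AB.
Qed.

Section Fixedk.
Variable k : nat.
Implicit Types (B : tidx k d -> tidx k d -> F) (Z : 'I_k -> 'M[F]_d).

Lemma tpair_sum (J : finType) (c : J -> F) (K : J -> tidx k d -> tidx k d -> F) Z :
  tpair (fun i l => \sum_x c x * K x i l) Z = \sum_x c x * tpair (K x) Z.
Proof.
under [RHS]eq_bigr => x _ do rewrite /tpair mulr_sumr.
rewrite [RHS]exchange_big; apply: eq_bigr => i _ /=.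
under [RHS]eq_bigr => x _ do rewrite mulr_sumr.
rewrite [RHS]exchange_big; apply: eq_bigr => l _ /=.
by rewrite mulr_suml; apply: eq_bigr => x _; rewrite mulrA.
Qed.

Lemma tpairZ B (c : 'I_k -> F) Z :
  tpair B (fun m => c m *: Z m) = (\prod_m c m) * tpair B Z.
Proof.
rewrite /tpair mulr_sumr; apply: eq_bigr => i _.
rewrite mulr_sumr; apply: eq_bigr => l _; rewrite mulrCA; congr (_ * _).
by rewrite -big_split; apply: eq_bigr => m _; rewrite mxE.
Qed.

Lemma mlin_tpair B : mlin (tpair B).
Proof.
apply: mlin_bigsum => i; apply: mlin_bigsum => l; apply: mlin_const_mul.
exact: mlin_entries.
Qed.

Lemma tpair_delta B (i j : tidx k d) :
  tpair B (fun m => delta_mx (j m) (i m)) = B i j.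
Proof.
have E (a b : tidx k d) :
    \prod_m (delta_mx (j m) (i m) : 'M[F]_d) (b m) (a m) = (b == j)%:R * (a == i)%:R.
  rewrite (eq_bigr (fun m => ((b m == j m) && (a m == i m))%:R)); last first.
    by move=> m _; rewrite mxE.
  rewrite prod_boolr -natrM mulnb; congr (_%:R); congr nat_of_bool.
  apply/forallP/andP => [H|[/eqP-> /eqP->] m]; last by rewrite !eqxx.
  by split; apply/eqP/ffunP => m; have /andP[/eqP ? /eqP ?] := H m.
rewrite /tpair (bigD1 i) //= [X in _ + X]big1 ?addr0 => [|a /negPf ai].
  rewrite (bigD1 j) //= [X in _ + X]big1 ?addr0 => [|b /negPf bj].
    by rewrite E !eqxx !mulr1.
  by rewrite E bj mul0r mulr0.
by apply: big1 => b _; rewrite E ai !mulr0.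
Qed.

(** Entries are values of [tpair] on matrix units, and multilinearity carries equality from [S] to
    those. *)
Lemma tpair_inj (S : 'M[F]_d -> Prop) B B' : spans S ->
  (forall Z, (forall m, S (Z m)) -> tpair B Z = tpair B' Z) ->
  forall i j, B i j = B' i j.
Proof.
move=> Ssp BB i j; rewrite -!tpair_delta.
exact: mlin_ext (@mlin_tpair B) (@mlin_tpair B') Ssp BB _.
Qed.

Definition tperm_op (s : 'S_k) : tidx k d -> tidx k d -> F :=
  fun i j => ([forall m, i m == j (s^-1%g m)])%:R.

Lemma tperm_opE (s : 'S_k) i j : tperm_op s i j = (j == [ffun m => i (s m)])%:R.
Proof.
congr (_%:R); congr nat_of_bool; apply/forallP/eqP => [H|-> m].
  by apply/ffunP => m; rewrite ffunE (eqP (H (s m))) permK.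
by rewrite ffunE permKV.
Qed.

Lemma tpair_perm (s : 'S_k) Z :
  tpair (tperm_op s) Z = \sum_(i : tidx k d) \prod_m Z m (i (s m)) (i m).
Proof.
apply: eq_bigr => i _; rewrite (bigD1 [ffun m => i (s m)]) //=.
rewrite [X in _ + X]big1 ?addr0 => [|b /negPf bl].
  by rewrite tperm_opE eqxx mul1r; apply: eq_bigr => m _; rewrite ffunE.
by rewrite tperm_opE bl mul0r.
Qed.

End Fixedk.

(** * Trace monomials as permutations *)

Section Terms.
Variable r : nat.
Implicit Types (w : seq 'I_r) (ws : seq (seq 'I_r)).

Definition tterm_val w ws (X : 'I_r -> 'M[F]_d) Y : F :=
  \tr ((\prod_(a <- w) X a) *m Y) * \prod_(v <- ws) \tr (\prod_(a <- v) X a).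

(** The untraced word becomes a cycle closed by the extra letter [ord_max], which stands for [Y]. *)
Definition term_cycles w ws : seq (seq 'I_r.+1) :=
  rcons (map (lift ord_max) w) ord_max :: map (map (lift ord_max)) ws.

Lemma term_cycles_count w ws :
  (forall i, count_mem i (w ++ flatten ws) = 1%N) <->
  uniq (flatten (term_cycles w ws)) /\ forall x, x \in flatten (term_cycles w ws).
Proof.
have P : perm_eq (flatten (term_cycles w ws))
    (ord_max :: map (lift ord_max) (w ++ flatten ws)).
  by rewrite /= -map_flatten map_cat -cat_cons perm_cat2r perm_rcons.
have Nmax s : ord_max \notin map (lift (@ord_max r)) s.
  by apply/mapP => -[x _ /eqP]; rewrite (negPf (neq_lift _ _)).
rewrite (perm_uniq P) /= Nmax /= (map_inj_uniq (@lift_inj _ _)).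
split=> [cnt|[U A] i].
  have mem i : i \in w ++ flatten ws by rewrite -has_pred1 has_count cnt.
  split; first by apply: count_mem_uniq => i; rewrite cnt mem.
  move=> x; rewrite (perm_mem P) inE; case: (unliftP ord_max x) => [y ->|->].
    by rewrite (mem_map (@lift_inj _ _)) mem orbT.
  by rewrite eqxx.
rewrite count_uniq_mem //; have := A (lift ord_max i).
rewrite (perm_mem P) inE eq_sym (negPf (neq_lift _ _)) /=.
by rewrite (mem_map (@lift_inj _ _)) => ->.
Qed.

Lemma term_cycles_formula (s : 'S_r.+1) w ws X Y :
  (forall i, count_mem i (w ++ flatten ws) = 1%N) -> [::] \notin ws ->
  perm_cycles s (term_cycles w ws) ->
  tpair (tperm_op s) (ext X Y) = tterm_val w ws X Y.
Proof.
move=> /term_cycles_count [U A] Nws sc; rewrite tpair_perm.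
rewrite (cycle_formula _ U A _ sc); last first.
  rewrite inE negb_or eq_sym -size_eq0 size_rcons /=.
  by apply: contra Nws => /mapP [[|//] vws _].
rewrite big_cons big_map /tterm_val; congr (_ * _).
  rewrite -cats1 big_cat big_seq1 big_map /= ext_max -[_ * _]/(_ *m _).
  by under eq_bigr => a _ do rewrite ext_lift.
apply: eq_bigr => v _; rewrite big_map.
by under eq_bigr => a _ do rewrite ext_lift.
Qed.

Lemma unlift_seq (c : seq 'I_r.+1) :
  ord_max \notin c -> exists w, c = map (lift ord_max) w.
Proof.
elim: c => [|x c IH]; first by exists [::].
rewrite inE negb_or => /andP[xm /IH [w ->]].
by case: (unliftP ord_max x) xm => [y ->|->] xm; [exists (y :: w)|rewrite eqxx in xm].
Qed.

Lemma unlift_seqs (cs : seq (seq 'I_r.+1)) :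
  ord_max \notin flatten cs -> exists ws, cs = map (map (lift ord_max)) ws.
Proof.
elim: cs => [|c cs IH]; first by exists [::].
rewrite /= mem_cat negb_or => /andP[/unlift_seq [w ->] /IH [ws ->]].
by exists (w :: ws).
Qed.

(** The cycle through [ord_max], cut at that letter, is the untraced word; the other cycles are the
    traced words. *)
Lemma term_of_perm (s : 'S_r.+1) : exists t : seq 'I_r * seq (seq 'I_r),
  (forall i, count_mem i (t.1 ++ flatten t.2) = 1%N) /\
  forall X Y, tpair (tperm_op s) (ext X Y) = tterm_val t.1 t.2 X Y.
Proof.
have [c [cs [U A N sc]]] := cycles_of_perm s ord_max.
have := U; rewrite /= cat_uniq rcons_uniq => /and3P[/andP[mc _] /hasPn dis _].
have mcs : ord_max \notin flatten cs.
  by apply/negP => /dis; rewrite /= mem_rcons mem_head.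
have [w cE] := unlift_seq mc; have [ws csE] := unlift_seqs mcs.
have cnt : forall i, count_mem i (w ++ flatten ws) = 1%N.
  by apply/term_cycles_count; rewrite /term_cycles -cE -csE.
exists (w, ws); split=> // X Y; apply: term_cycles_formula => //=.
  apply: contra N => Nws; rewrite csE.
  by apply/mapP; exists [::].
by rewrite /term_cycles -cE -csE.
Qed.

(** Empty traced words belong to no cycle; each contributes the trace [d] of the identity, collected
    in the constant [c]. *)
Lemma perm_of_term w ws : (forall i, count_mem i (w ++ flatten ws) = 1%N) ->
  exists (s : 'S_r.+1) (c : F), forall X Y,
    tterm_val w ws X Y = c * tpair (tperm_op s) (ext X Y).
Proof.
pose ws' := filter (predC1 [::]) ws.
have fE : flatten ws' = flatten ws.
  by rewrite /ws'; elim: ws {ws'} => //= -[|a v] ws /= ->.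
rewrite -fE => cnt; have /term_cycles_count [U A] := cnt.
have [s sc] := perm_of_cycles U A.
exists s, (d%:R ^+ count_mem [::] ws) => X Y.
rewrite (term_cycles_formula X Y cnt _ sc); last by rewrite mem_filter.
rewrite /tterm_val mulrCA; congr (_ * _).
rewrite /ws' big_filter /=; elim: ws {ws' fE cnt U A sc} => [|v ws IH].
  by rewrite !big_nil mulr1.
rewrite !big_cons IH /=; case: (eqVneq v [::]) => [->|_] /=.
  by rewrite big_nil exprS mulrA mxtrace1.
by rewrite mulrCA.
Qed.

Definition teval (p : seq (F * (seq 'I_r * seq (seq 'I_r)))) (X : 'I_r -> 'M[F]_d) :
    'M[F]_d :=
  \sum_(t <- p) (t.1 * \prod_(v <- t.2.2) \tr (\prod_(a <- v) X a)) *: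
     \prod_(a <- t.2.1) X a.

Lemma mxtrace_teval p X Y :
  \tr (teval p X *m Y) = \sum_(t <- p) t.1 * tterm_val t.2.1 t.2.2 X Y.
Proof.
rewrite /teval mulmx_suml raddf_sum; apply: eq_bigr => t _ /=.
by rewrite -scalemxAl mxtraceZ /tterm_val -mulrA [in RHS](mulrC (\tr _)).
Qed.

Definition tperm_comb (alpha : {ffun 'S_r.+1 -> F}) : tidx r.+1 d -> tidx r.+1 d -> F :=
  fun i j => \sum_s alpha s * tperm_op s i j.

Lemma teval_tperm_comb (p : seq (F * (seq 'I_r * seq (seq 'I_r)))) :
  (forall t, t \in p -> forall i, count_mem i (t.2.1 ++ flatten t.2.2) = 1%N) ->
  exists alpha, forall X, teval p X = pfun (tperm_comb alpha) X.
Proof.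
move=> pm; suff [alpha aE] : exists alpha, forall X Y,
    \tr (teval p X *m Y) = tpair (tperm_comb alpha) (ext X Y).
  by exists alpha => X; apply: mxtrace_mul_ext => Y; rewrite aE pfun_pair.
elim: p pm => [|t p IH] pm.
  exists [ffun=> 0] => X Y; rewrite tpair_sum mxtrace_teval big_nil big1 // => s _.
  by rewrite ffunE mul0r.
have [|alpha aE] := IH; first by move=> u up; apply: pm; rewrite inE up orbT.
have [s [c sE]] := perm_of_term (pm t (mem_head _ _)).
exists [ffun s' => alpha s' + (s' == s)%:R * (t.1 * c)] => X Y.
have := aE X Y; rewrite !mxtrace_teval big_cons => ->; rewrite !tpair_sum.
under [RHS]eq_bigr => s' _ do rewrite ffunE mulrDl.
rewrite big_split addrC; congr (_ + _) => /=.
rewrite (bigD1 s) //= big1 ?addr0 => [|s' /negPf ->]; last by rewrite !mul0r.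
by rewrite eqxx mul1r sE mulrA.
Qed.

Lemma tperm_comb_teval alpha : exists p : seq (F * (seq 'I_r * seq (seq 'I_r))),
  (forall t, t \in p -> forall i, count_mem i (t.2.1 ++ flatten t.2.2) = 1%N) /\
  forall X, pfun (tperm_comb alpha) X = teval p X.
Proof.
have [t tP] := choice term_of_perm.
exists [seq (alpha s, t s) | s <- enum {: 'S_r.+1}]; split.
  by move=> _ /mapP [s _ ->]; case: (tP s).
move=> X; apply: mxtrace_mul_ext => Y; rewrite pfun_pair mxtrace_teval.
rewrite big_map big_enum tpair_sum; apply: eq_bigr => s _ /=.
by case: (tP s) => _ ->.
Qed.

End Terms.
End Pairing.

(** * Block positivity *)

Section Positivity.
Variables (C : numClosedFieldType) (d : nat).
Local Notation adjmx A := (map_mx Num.conj A^T).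

Definition statemx (A : 'M[C]_d) := psdmx A /\ \tr A = 1.

Lemma spans_dyad : spans (fun A : 'M[C]_d => exists v : 'cV_d, A = v *m adjmx v).
Proof.
move=> phi L phi0; apply: (spans_delta L) => _ [[i j] ->] /=.
have [v1 [v2 [v3 [v4 ->]]]] := delta_mx_dyadsE C i j.
rewrite (linZ _ _ L) (linD _ _ L) (linZ _ _ L) !(linB _ _ L).
rewrite !phi0 ?subrr ?mulr0 ?addr0 ?mulr0 //; by [exists v1|exists v2|exists v3|exists v4].
Qed.

Lemma psd_normalize (A : 'M[C]_d) : psdmx A -> A != 0 ->
  statemx ((\tr A)^-1 *: A) /\ \tr A != 0.
Proof.
move=> A0 An0; have trn0 : \tr A != 0.
  by apply: contra An0 => /eqP /(psd_tr_eq0 A0) ->.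
split=> //; split; last by rewrite mxtraceZ mulVf.
by apply: psdZ => //; rewrite invr_ge0 psd_tr_ge0.
Qed.

Section Fixedk.
Variable k : nat.
Implicit Types (B : tidx k d -> tidx k d -> C) (Z : 'I_k -> 'M[C]_d).

(** Block positivity freed from normalization: the common form of positivity of [B] on separable
    states and of [pfun B] on the cone. *)
Definition prod_pos B := forall Z, (forall m, psdmx (Z m)) -> 0 <= tpair B Z.

Lemma tpair_normalize B Z : (forall m, psdmx (Z m)) ->
  tpair B Z = (\prod_m \tr (Z m)) * tpair B (fun m => (\tr (Z m))^-1 *: Z m).
Proof.
move=> Z0; rewrite -tpairZ; congr tpair; apply/funext => m.
(* A positive semidefinite matrix of trace 0 is 0, so the convention that 0 inverts to 0 is
   harmless. *)
case: (eqVneq (\tr (Z m)) 0) => [t0|tn0].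
  by rewrite (psd_tr_eq0 (Z0 m) t0) !scaler0.
by rewrite scalerA mulfV // scale1r.
Qed.

Lemma prod_pos_state B :
  (forall Z, (forall m, statemx (Z m)) -> 0 <= tpair B Z) -> prod_pos B.
Proof.
move=> Bst Z Z0; rewrite tpair_normalize //.
case: (boolP [exists m, Z m == 0]) => [/existsP [m /eqP Zm]|/existsPn Zn].
  by rewrite (bigD1 m) //= Zm mxtrace0 !mul0r.
rewrite mulr_ge0 ?prodr_ge0 // => [m _|]; first exact: psd_tr_ge0.
by apply: Bst => m; case: (psd_normalize (Z0 m) (Zn m)).
Qed.

(** On tuples of dyads the pairing is real, so [B] and its adjoint agree there; dyads span. *)
Lemma prod_pos_hermitian B : prod_pos B -> forall i j, B i j = (B j i)^*.
Proof.
move=> Bpos; apply: (tpair_inj spans_dyad) => Z Zdyad.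
have Z0 m : psdmx (Z m) by have [v ->] := Zdyad m; exact: psd_dyad.
have /CrealP <- := ger0_real (Bpos Z Z0).
rewrite /tpair rmorph_sum [RHS]exchange_big; apply: eq_bigr => i _ /=.
rewrite rmorph_sum; apply: eq_bigr => l _ /=.
rewrite rmorphM rmorph_prod /=; congr (_ * _); apply: eq_bigr => m _.
by rewrite -{2}(psd_hermitian (Z0 m)) !mxE.
Qed.

Lemma tpair_mix B n (p : 'I_n -> C) (Zs : 'I_n -> 'I_k -> 'M[C]_d) :
  \sum_i \sum_l B i l * (\sum_x p x * \prod_m Zs x m (l m) (i m)) =
  \sum_x p x * tpair B (Zs x).
Proof.
under [RHS]eq_bigr => x _ do rewrite /tpair mulr_sumr.
rewrite [RHS]exchange_big; apply: eq_bigr => i _ /=.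
under [RHS]eq_bigr => x _ do rewrite mulr_sumr.
rewrite [RHS]exchange_big; apply: eq_bigr => l _ /=.
by rewrite mulr_sumr; apply: eq_bigr => x _; rewrite mulrCA.
Qed.

Lemma op_comm_perm (U : 'M[C]_d) (s : 'S_k) :
  op_comm (tpow U) (@tperm_op C d k s).
Proof.
move=> i j; pose l' : tidx k d := [ffun m => j (s^-1%g m)].
have l'E (b : tidx k d) : tperm_op C s b j = (b == l')%:R.
  congr (_%:R); congr nat_of_bool; apply/forallP/eqP => [H|-> m].
    by apply/ffunP => m; rewrite ffunE (eqP (H m)).
  by rewrite ffunE.
rewrite (bigD1 l') //= [X in _ + X]big1 ?addr0 => [|b /negPf bl]; last first.
  by rewrite l'E bl mulr0.
rewrite (bigD1 [ffun m => i (s m)]) //= [X in _ + X]big1 ?addr0 => [|b /negPf bl]; last first.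
  by rewrite tperm_opE bl mul0r.
rewrite l'E tperm_opE !eqxx mulr1 mul1r /tpow (reindex_perm s) /=.
by apply: eq_bigr => m _; rewrite !ffunE permK.
Qed.

End Fixedk.

Section Witness.
Variable r : nat.
Implicit Types (B : tidx r.+1 d -> tidx r.+1 d -> C) (X : 'I_r -> 'M[C]_d).

Lemma op_comm_tperm_comb (U : 'M[C]_d) (alpha : {ffun 'S_r.+1 -> C}) :
  op_comm (tperm_comb alpha) (tpow U).
Proof.
apply/op_commE; apply/esym/op_commE.
by apply: op_comm_sum => s; exact: op_comm_perm.
Qed.

Lemma ext_psd X Y : (forall i, psdmx (X i)) -> psdmx Y -> forall m, psdmx (ext X Y m).
Proof. by move=> X0 Y0 m; rewrite /ext; case: unlift. Qed.

(** The form of [pfun B X] at [v] is the pairing with the dyad of [v] in the last slot; conversely,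
    the trace of a product of two positive semidefinite matrices is nonnegative. *)
Lemma prod_pos_pfun B : prod_pos B <->
  forall X, (forall i, psdmx (X i)) -> psdmx (pfun B X).
Proof.
split=> [Bpos X X0 v|fpos Z Z0].
  rewrite -trmulmx_dyad pfun_pair; apply: Bpos; apply: ext_psd => //.
  exact: psd_dyad.
by rewrite -(extE Z) -pfun_pair; apply: psd_trM_ge0 => //; exact: fpos.
Qed.

(** A kernel vector [v] gives the last factor as its normalized dyad. Conversely, the last factor
    has zero trace against the positive semidefinite [pfun B X], and [psd_trM_eq0] extracts a kernel
    vector. *)
Lemma optimal_pfun B : prod_pos B ->
  (exists X, (forall i, psdmx (X i) /\ X i != 0) /\
     exists2 v : 'cV[C]_d, v != 0 & pfun B X *m v = 0) <->
  (exists Z, (forall m, statemx (Z m)) /\ tpair B Z = 0).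
Proof.
move=> Bpos; split=> [[X [X0 [v vn0 fv]]]|[Z [Zst BZ]]].
  pose Z := ext X (v *m adjmx v).
  have Z0 m : psdmx (Z m).
    by apply: ext_psd => [i|]; [case: (X0 i)|exact: psd_dyad].
  have Zn m : Z m != 0.
    rewrite /Z /ext; case: unlift => [i|]; first by case: (X0 i).
    apply: contra vn0 => /eqP vv; apply/eqP/normsq_cV_eq0.
    by rewrite -tr_dyad vv mxtrace0.
  exists (fun m => (\tr (Z m))^-1 *: Z m); split=> [m|].
    by case: (psd_normalize (Z0 m) (Zn m)).
  have : tpair B Z = 0.
    by rewrite -pfun_pair trmulmx_dyad -mulmxA fv mulmx0 mxE.
  rewrite tpair_normalize // => /eqP; rewrite mulf_eq0 => /orP[|/eqP //].
  by case/prodf_eq0 => m _; case: (psd_normalize (Z0 m) (Zn m)) => _ /negPf ->.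
have stn0 m : Z m != 0.
  apply/eqP => Zm; have [_] := Zst m; rewrite Zm mxtrace0 => /eqP.
  by rewrite eq_sym oner_eq0.
exists (fun m => Z (lift ord_max m)); split.
  by move=> i; split=> //; case: (Zst (lift ord_max i)).
apply: (@psd_trM_eq0 _ _ _ (Z ord_max)) => //.
- by have /prod_pos_pfun := Bpos; apply => i; case: (Zst (lift ord_max i)).
- by case: (Zst ord_max).
- by rewrite pfun_pair extE.
Qed.

End Witness.
End Positivity.

(** * Translation to the definitions of the statement *)

Section Interface.
Variable R : realType.
Local Notation C := R[i].

Lemma separable_tens k d (Z : 'I_k -> 'M[C]_d) :
  (forall m, state (Z m)) -> separable (tens Z).
Proof.
move=> Zst; exists 1%N, (fun _ => 1), (fun _ => Z); split=> //.
split; first by rewrite big_ord1.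
split=> //; apply/funext => i; apply/funext => j.
by rewrite big_ord1 mul1r.
Qed.

Lemma block_positiveP k d (B : top R k d) : block_positive B <-> prod_pos B.
Proof.
split=> [Bbp|Bpos rho [n [p [Zs [p0 [_ [Zst ->]]]]]]].
  by apply: prod_pos_state => Z Zst; apply: Bbp; exact: separable_tens.
rewrite /top_tr /top_mul tpair_mix sumr_ge0 // => x _.
by apply: mulr_ge0 => //; apply: Bpos => m; case: (Zst x m).
Qed.

(** A convex combination of nonnegative values is zero only if every product state of nonzero weight
    gives zero, and some weight is nonzero as they sum to 1. *)
Lemma separable_tr_eq0 k d (B : top R k d) : block_positive B ->
  (exists rho, separable rho /\ top_tr (top_mul B rho) = 0) <->
  exists Z, (forall m, statemx (Z m)) /\ tpair B Z = 0.
Proof.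
move=> /block_positiveP Bpos; split=> [[rho [[n [p [Zs [p0 [p1 [Zst ->]]]]]]]]|].
  rewrite /top_tr /top_mul tpair_mix => /eqP; rewrite psumr_eq0; last first.
    by move=> x _; apply: mulr_ge0 => //; apply: Bpos => m; case: (Zst x m).
  move=> /allP z; have [x px] : exists x, p x != 0.
    case: (boolP [exists x, p x != 0]) => [/existsP //|/existsPn pz].
    have : \sum_(l < n) p l = 0.
      by apply: big1 => l _; apply/eqP; have := pz l; rewrite negbK.
    by rewrite p1 => /eqP; rewrite oner_eq0.
  exists (Zs x); split=> [m|]; first exact: Zst.
  by have /= := z x (mem_index_enum x); rewrite mulf_eq0 (negPf px) => /eqP.
by move=> [Z [Zst BZ]]; exists (tens Z); split; first exact: separable_tens.
Qed.

Lemma unitary_invariantP k d (B : top R k d) : unitary_invariant B <->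
  forall U, unitary U -> op_comm B (tpow U).
Proof. by split=> H U uU; apply/(op_comm_conj B uU); exact: H. Qed.

Lemma schur_weyl_That k d (B : top R k d) : unitary_invariant B ->
  exists alpha, B = That d alpha.
Proof.
move=> /unitary_invariantP/(@schur_weyl _ k d B) [alpha BE]; exists alpha.
by apply/funext => i; apply/funext => j; exact: BE.
Qed.

Lemma optimal_tp_ineqP r d (B : top R r.+1 d) : block_positive B ->
  optimal_tp_ineq (fB B) <->
  exists rho, separable rho /\ top_tr (top_mul B rho) = 0.
Proof.
move=> Bbp; have /block_positiveP Bpos := Bbp; have /prod_pos_pfun fpos := Bpos.
rewrite (separable_tr_eq0 Bbp) -(optimal_pfun Bpos); split.
  move=> [_ [X [X0 sev]]]; exists X; split=> //.
  have fX0 : psdmx (pfun B X) by apply: fpos => i; case: (X0 i).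
  exact/(psd_smallest_eigenvalue_zeroP fX0).
move=> [X [X0 ev]]; split; first exact: fpos.
exists X; split=> //; have fX0 : psdmx (pfun B X) by apply: fpos => i; case: (X0 i).
exact/(psd_smallest_eigenvalue_zeroP fX0).
Qed.

End Interface.

Theorem theorem5 (R : realType) (d r : nat) (hd : (1 <= d)%N) (hr : (1 <= r)%N) :
  (* (1) *)
  (forall p : tpoly R r, tp_multilinear p ->
     pos_on_cone (fun X : 'I_r -> 'M[R[i]]_d => tp_eval p X) ->
     exists alpha : {ffun 'S_r.+1 -> R[i]},
       (forall X : 'I_r -> 'M[R[i]]_d, tp_eval p X = fB (That d alpha) X) /\
       top_hermitian (That d alpha) /\ block_positive (That d alpha) /\
       unitary_invariant (That d alpha)) /\
  (* (2) *)
  (forall B : top R r.+1 d, block_positive B -> unitary_invariant B ->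
     (exists p : tpoly R r, tp_multilinear p /\
        forall X : 'I_r -> 'M[R[i]]_d, fB B X = tp_eval p X) /\
     pos_on_cone (fB B)) /\
  (* (3) *)
  (forall W : top R r.+1 d, unitary_invariant W -> entanglement_witness W ->
     (optimal_tp_ineq (fB W) <-> optimal_witness W)).
Proof.
split; [|split].
- move=> p pm fpos; have [alpha aE] := teval_tperm_comb d pm.
  (* Hermiticity and block positivity both follow from this; invariance holds for every combination
     of permutation operators. *)
  have Bpos : prod_pos (tperm_comb alpha : top R r.+1 d).
    by apply/prod_pos_pfun => X X0; rewrite -aE; exact: fpos.
  exists alpha; split; first exact: aE.
  split; first exact: (prod_pos_hermitian Bpos).
  split; first exact/block_positiveP.
  by apply/unitary_invariantP => U _; exact: op_comm_tperm_comb.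
- move=> B Bbp /schur_weyl_That [alpha BE]; split.
    have [p [pm pE]] := tperm_comb_teval d alpha.
    by exists p; split=> // X; rewrite BE; exact: pE.
  by have /block_positiveP/prod_pos_pfun := Bbp.
(* Given a witness, both notions of optimality amount to vanishing on some separable state. *)
- move=> W _ Wew; have [Wbp _] := Wew; rewrite (optimal_tp_ineqP Wbp).
  by split=> [|[]].
Qed.
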